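(* Let $X:\Omega\to\mathbb{C}^{N\times m}$ be a solution of the Grassmannian sigma model equations with associated surface $Z:\Omega\to\mathfrak{su}(N)$, and let $\det G\neq0$ on a neighborhood $\Upsilon\subset\Omega$ of a point $(\xi_L^0,\xi_R^0)$. Let $\Phi:\Upsilon\to SU(N)$ be smooth with $$X(\xi_L,\xi_R)=\Phi(\xi_L,\xi_R)\begin{pmatrix}\mathbf{1}_{m\times m}\\ \mathbf{0}_{n\times m}\end{pmatrix}\quad\text{on }\Upsilon,$$ put $\partial_D^\Phi Z=\Phi^\dagger\,\partial_D Z\,\Phi$ ($D=L,R$), and let $\tilde A_{jk},\tilde B_{jk},\tilde C_p$ be the matrices, depending smoothly on the point of $\Upsilon$, obtained from $\partial^\Phi_L Z,\partial^\Phi_R Z$ by the Gram--Schmidt procedure described in the context. Consider on $\Upsilon$ the moving frame $$\partial_L Z=\Phi\,\partial_L^\Phi Z\,\Phi^\dagger,\quad \partial_R Z=\Phi\,\partial_R^\Phi Z\,\Phi^\dagger,\quad n^A_{jk}=\Phi\tilde A_{jk}\Phi^\dagger,\quad n^B_{jk}=\Phi\tilde B_{jk}\Phi^\dagger,\quad n^C_p=\Phi\tilde C_p\Phi^\dagger,$$ where the indices run through all values for which $\tilde A,\tilde B,\tilde C$ are defined. Then, denoting the matrices $n^A_{jk},n^B_{jk},n^C_p$ in some order by $n_3,\ldots,n_{N^2-1}$, the frame satisfies the normalization conditions $$(\partial_L Z,\partial_L Z)=J_L,\quad(\partial_L Z,\partial_R Z)=G_{LR},\quad(\partial_R Z,\partial_R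 Z)=J_R,\quad(\partial_L Z,n_k)=(\partial_R Z,n_k)=0,\quad(n_j,n_k)=\delta_{jk},$$ and consequently the Gauss--Weingarten equations: there are real-valued functions $H_j,Q^L_j,Q^R_j,s^L_{jk},s^R_{jk}$ on $\Upsilon$, with $s^D_{jk}+s^D_{kj}=0$ for $D=L,R$, such that (summation over repeated lower-case indices from $3$ to $N^2-1$) $$\begin{aligned} \partial_L\partial_L Z&=A^L_L\partial_L Z+A^L_R\partial_R Z+Q^L_jn_j, & \partial_R\partial_R Z&=A^R_L\partial_L Z+A^R_R\partial_R Z+Q^R_jn_j,\\ \partial_L\partial_R Z&=\partial_R\partial_L Z=H_jn_j, & &\\ \partial_L n_j&=\alpha^L_j\partial_L Z+\beta^L_j\partial_R Z+s^L_{jk}n_k, & \partial_R n_j&=\alpha^R_j\partial_L Z+\beta^R_j\partial_R Z+s^R_{jk}n_k, \end{aligned}$$ with the coefficients $A^D_L,A^D_R,\alpha^D_j,\beta^D_j$ given in the context.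
   Context: Let $m,n\ge 1$ and $N=m+n$. Let $\Omega\subset\mathbb{R}^2$ be open, connected and simply connected, with light-cone coordinates $\xi_L=\xi^0+\xi^1$, $\xi_R=\xi^0-\xi^1$, and write $\partial_L=\partial/\partial\xi_L$, $\partial_R=\partial/\partial\xi_R$. A dagger denotes the conjugate transpose, and $\partial_D X^\dagger=\partial_D(X^\dagger)$. A smooth map $X:\Omega\to\mathbb{C}^{N\times m}$ with $X^\dagger X=\mathbf{1}_{m\times m}$ represents a map into the Grassmannian $G(m,n)=SU(N)/S(U(m)\times U(n))$. Put $P=\mathbf{1}-XX^\dagger$, an orthogonal projector. $X$ is called a solution of the Grassmannian sigma model (Euler--Lagrange) equations if $[\partial_L\partial_R P,P]=0$ on $\Omega$, equivalently $\partial_L[\partial_R P,P]+\partial_R[\partial_L P,P]=0$. The algebra $\mathfrak{su}(N)$ of traceless anti-Hermitian $N\times N$ matrices is equipped with the scalar product $(A,B)=-\frac12\operatorname{tr}(AB)$. For a solution $X$, the associated surface is the smooth map $Z:\Omega\to\mathfrak{su}(N)$, unique up to an additive constant, with $\partial_L Z=[\partial_L P,P]$, $\partial_R Z=-[\partial_R P,P]$. Put $$J_D=\operatorname{tr}(\partial_D X\,\partial_D X^\dagger P)\ (D=L,R),\qquad G_{LR}=-\tfrac12\operatorname{tr}\big((\partial_L X\,\partial_R X^\dagger+\partial_R X\,\partial_L X^\dagger)P\big),\qquad \det G=J_LJ_R-G_{LR}^2 .$$ Orthonormal basis of $\mathfrak{su}(N)$: for $1\le j<k\le N$ and $1\le p\le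 N-1$, $$(A_{jk})_{ab}=i(\delta_{ja}\delta_{kb}+\delta_{jb}\delta_{ka}),\quad (B_{jk})_{ab}=\delta_{ja}\delta_{kb}-\delta_{jb}\delta_{ka},\quad (C_p)_{ab}=i\sqrt{\tfrac{2}{p(p+1)}}\Big(\sum_{d=1}^p\delta_{da}\delta_{db}-p\,\delta_{p+1,a}\delta_{p+1,b}\Big).$$ The matrices with tildes. With $\Phi$ as in the claim, $\partial_D^\Phi Z=\Phi^\dagger\partial_D Z\,\Phi$ has vanishing diagonal blocks with respect to the block decomposition $N=m+n$. By Gram--Schmidt orthogonalization one takes, at each point of $\Upsilon$, orthonormal matrices $\tilde A_{aj},\tilde B_{aj}\in\mathfrak{su}(N)$ for $a=1,\ldots,m$, $j=m+1,\ldots,N$, $a+j>m+2$, orthogonal to both $\partial_L^\Phi Z$ and $\partial_R^\Phi Z$, such that the real span of $\partial_L^\Phi Z,\partial_R^\Phi Z$ and all these $\tilde A_{aj},\tilde B_{aj}$ equals the real span of $\{A_{aj},B_{aj}: a=1,\ldots,m,\ j=m+1,\ldots,N\}$. The remaining ones are $\tilde A_{jk}=A_{jk}$, $\tilde B_{jk}=B_{jk}$ for $j<k$ with both $j,k\in\{1,\ldots,m\}$ or both $j,k\in\{m+1,\ldots,N\}$, and $\tilde C_p=C_p$ for $1\le p\le N-1$. (The matrices $\tilde A_{1,m+1},\tilde B_{1,m+1}$ are not defined.) Coefficients in the Gauss--Weingarten equations: $$\alpha^L_j=\tfrac{H_jG_{LR}-Q^L_jJ_R}{\det G},\quad \beta^L_j=\tfrac{Q^L_jG_{LR}-H_jJ_L}{\det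 G},\quad \alpha^R_j=\tfrac{Q^R_jG_{LR}-H_jJ_R}{\det G},\quad \beta^R_j=\tfrac{H_jG_{LR}-Q^R_jJ_L}{\det G},$$ $$A^D_L=\tfrac{1}{\det G}\big(J_R(\partial_D\partial_D Z,\partial_L Z)-G_{LR}(\partial_D\partial_D Z,\partial_R Z)\big),\quad A^D_R=\tfrac{1}{\det G}\big(J_L(\partial_D\partial_D Z,\partial_R Z)-G_{LR}(\partial_D\partial_D Z,\partial_L Z)\big)\quad(D=L,R),$$ where, for $B,D\in\{L,R\}$ (no summation), $$(\partial_B\partial_B Z,\partial_D Z)=\left(\delta_{B,D}-\tfrac12\right)\operatorname{tr}\Big((\partial_B\partial_B X\,\partial_D X^\dagger+\partial_D X\,\partial_B\partial_B X^\dagger)P+2\,\partial_B X\,\partial_B X^\dagger\,(X\,\partial_D X^\dagger+\partial_D X\,X^\dagger)\Big).$$ *)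

(* Defs.v *)
(* MathComp / MathComp-Analysis *)
From mathcomp Require Import all_boot all_order all_algebra.
From mathcomp Require Import sesquilinear spectral complex.
From mathcomp Require Import all_classical all_reals all_analysis.

Set Implicit Arguments.
Unset Strict Implicit.
Unset Printing Implicit Defensive.

Import Order.TTheory GRing.Theory Num.Theory.
Import numFieldNormedType.Exports.

Local Open Scope classical_set_scope.
Local Open Scope ring_scope.
Local Open Scope complex_scope.
Local Open Scope sesquilinear_scope.

(* The light-cone labels L and R are booleans. *)
Notation L_ := true (only parsing).
Notation R_ := false (only parsing).

Section PlaneCalculus.
Variable R : realType.
Implicit Types U : set (R * R)%type.

(* A point of the plane is the pair (xi^0, xi^1). *)

Definition simply_connected U : Prop :=
  forall g : R -> R * R,
    {within `[0, 1]%classic, continuous g} ->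
    g @` `[0, 1]%classic `<=` U -> g 0 = g 1 ->
  exists h : R * R -> R * R,
    [/\ {within `[0, 1]%classic `*` `[0, 1]%classic, continuous h},
        h @` (`[0, 1]%classic `*` `[0, 1]%classic) `<=` U,
        forall t, `[0, 1]%classic t -> h (t, 0) = g t /\ h (t, 1) = g 0
      & forall s, `[0, 1]%classic s -> h (0, s) = g 0 /\ h (1, s) = g 0].

Fixpoint Ck (k : nat) U (f : R * R -> R) : Prop :=
  match k with
  | 0 => forall x, U x -> {for x, continuous f}
  | k'.+1 => (forall x, U x -> differentiable f x) /\
             forall v : R * R, Ck k' U ('D_v f)
  end.

Definition smooth U (f : R * R -> R) : Prop := forall k, Ck k U f.

Definition smooth_mx p q U (F : R * R -> 'M[R[i]]_(p, q)) : Prop :=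
  forall i j, smooth U (fun x => complex.Re (F x i j)) /\
              smooth U (fun x => complex.Im (F x i j)).

(* Since xi_L = xi^0 + xi^1 and xi_R = xi^0 - xi^1, d/dxi_L and d/dxi_R are
   the derivatives along (1/2, 1/2) and (1/2, -1/2). *)
Definition lc_dir (D : bool) : R * R := (2^-1, if D then 2^-1 else - 2^-1).

Definition pd p q (D : bool) (F : R * R -> 'M[R[i]]_(p, q)) :
    R * R -> 'M[R[i]]_(p, q) := fun x =>
  \matrix_(i, j) ('D_(lc_dir D) (fun y => complex.Re (F y i j)) x +i*
                  'D_(lc_dir D) (fun y => complex.Im (F y i j)) x).

End PlaneCalculus.

Section SpecialUnitary.
Variables (R : realType) (N : nat).
Implicit Types A B : 'M[R[i]]_N.

Definition comm A B := A *m B - B *m A.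

Definition SU A : Prop := A \is unitarymx /\ \det A = 1.

Definition su A : Prop := A^t* = - A /\ \tr A = 0.

(* Complex-valued on all matrices, real-valued on su(N). *)
Definition sprod A B : R[i] := - 2^-1 * \tr (A *m B).

Definition real_span (I : finType) (F : I -> 'M[R[i]]_N) : set 'M[R[i]]_N :=
  [set A | exists c : I -> R, A = \sum_i (c i)%:C *: F i].

(* The standard basis with rows and columns numbered from 0: below, basisA j k
   is A_{j+1,k+1}, basisB j k is B_{j+1,k+1} and basisC p is C_{p+1}. *)
Definition basisA (j k : 'I_N) : 'M[R[i]]_N :=
  \matrix_(a, b) ('i%C * (((j == a) && (k == b))%:R + ((j == b) && (k == a))%:R)).

Definition basisB (j k : 'I_N) : 'M[R[i]]_N :=
  \matrix_(a, b) (((j == a) && (k == b))%:R - ((j == b) && (k == a))%:R).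

Definition basisC (p : 'I_N.-1) : 'M[R[i]]_N :=
  \matrix_(a, b) ('i%C * (Num.sqrt (2 / (p.+1%:R * p.+2%:R)))%:C *
    (\sum_(d < p.+1) ((d == a :> nat) && (d == b :> nat))%:R
     - p.+1%:R * ((p.+1 == a) && (p.+1 == b))%:R)).

End SpecialUnitary.

Section Model.
Variables (R : realType) (m n : nat).
Local Notation N := (m + n)%N.
Local Notation plane := (R * R)%type.
Implicit Types (X : plane -> 'M[R[i]]_(N, m)) (Z Phi : plane -> 'M[R[i]]_N).

Definition proj X x : 'M[R[i]]_N := 1%:M - X x *m (X x)^t*.

Definition sigma_solution (Omega : set plane) X : Prop :=
  [/\ smooth_mx Omega X,
      forall x, Omega x -> (X x)^t* *m X x = 1%:M
    & forall x, Omega x -> comm (pd L_ (pd R_ (proj X)) x) (proj X x) = 0].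

Definition associated_surface (Omega : set plane) X Z : Prop :=
  [/\ smooth_mx Omega Z,
      forall x, Omega x -> su (Z x),
      forall x, Omega x -> pd L_ Z x = comm (pd L_ (proj X) x) (proj X x)
    & forall x, Omega x -> pd R_ Z x = - comm (pd R_ (proj X) x) (proj X x)].

Definition pdadj X (D : bool) : plane -> 'M[R[i]]_(m, N) :=
  pd D (fun x => (X x)^t*).

Definition J X (D : bool) x : R[i] :=
  \tr (pd D X x *m pdadj X D x *m proj X x).

Definition GLR X x : R[i] :=
  - 2^-1 * \tr ((pd L_ X x *m pdadj X R_ x + pd R_ X x *m pdadj X L_ x)
                *m proj X x).

Definition detG X x : R[i] := J X L_ x * J X R_ x - GLR X x ^+ 2.

(* Explicit expression, in terms of X, of the product of d_B d_B Z and d_D Z. *)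
Definition ddZ_dZ X (B D : bool) x : R[i] :=
  ((B == D)%:R - 2^-1) *
  \tr ((pd B (pd B X) x *m pdadj X D x
        + pd D X x *m pd B (pdadj X B) x) *m proj X x
       + 2 *: (pd B X x *m pdadj X B x
               *m (X x *m pdadj X D x + pd D X x *m (X x)^t*))).

Definition coefA_L X Z (D : bool) x : R[i] :=
  (J X R_ x * sprod (pd D (pd D Z) x) (pd L_ Z x)
   - GLR X x * sprod (pd D (pd D Z) x) (pd R_ Z x)) / detG X x.

Definition coefA_R X Z (D : bool) x : R[i] :=
  (J X L_ x * sprod (pd D (pd D Z) x) (pd R_ Z x)
   - GLR X x * sprod (pd D (pd D Z) x) (pd L_ Z x)) / detG X x.

Definition alphaL X (H Q : R) x : R[i] :=
  (H%:C * GLR X x - Q%:C * J X R_ x) / detG X x.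
Definition betaL X (H Q : R) x : R[i] :=
  (Q%:C * GLR X x - H%:C * J X L_ x) / detG X x.
Definition alphaR X (H Q : R) x : R[i] :=
  (Q%:C * GLR X x - H%:C * J X R_ x) / detG X x.
Definition betaR X (H Q : R) x : R[i] :=
  (H%:C * GLR X x - Q%:C * J X L_ x) / detG X x.

Definition pdPhi Phi Z (D : bool) x : 'M[R[i]]_N :=
  (Phi x)^t* *m pd D Z x *m Phi x.

(* Index pairs (j, k) with j < k, numbered from 0; (0, m) is the pair written
   (1, m+1) when counting from 1, for which no tilded matrix is defined. *)
Definition missing (p : 'I_N * 'I_N) : bool :=
  (p.1 == 0 :> nat) && (p.2 == m :> nat).
Definition mixed (p : 'I_N * 'I_N) : bool := (p.1 < m <= p.2)%N.

Definition mixed_pair := {p : 'I_N * 'I_N | mixed p}.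
Definition tilde_mixed_pair := {p : 'I_N * 'I_N | mixed p && ~~ missing p}.
Definition tilde_pair :=
  {p : 'I_N * 'I_N | (p.1 < p.2)%N && ~~ missing p}.


(* The values of tA and tB at a pair which is not a tilde_pair are irrelevant.
   The pointwise requirements on the mixed ones are those which characterize the
   outcome of a Gram-Schmidt process started from U_L, U_R. *)
Record tilde_matrices (Upsilon : set plane) (U_L U_R : plane -> 'M[R[i]]_N)
    (tA tB : 'I_N * 'I_N -> plane -> 'M[R[i]]_N) : Prop := TildeMatrices {
  tilde_smooth : forall p : tilde_mixed_pair,
    smooth_mx Upsilon (tA (val p)) /\ smooth_mx Upsilon (tB (val p));
  tilde_su : forall (p : tilde_mixed_pair) x, Upsilon x ->
    su (tA (val p) x) /\ su (tB (val p) x);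
  tilde_orthonormal : forall (p q : tilde_mixed_pair) x, Upsilon x ->
    [/\ sprod (tA (val p) x) (tA (val q) x) = (p == q)%:R,
        sprod (tB (val p) x) (tB (val q) x) = (p == q)%:R
      & sprod (tA (val p) x) (tB (val q) x) = 0];
  tilde_orthogonal : forall (p : tilde_mixed_pair) x, Upsilon x ->
    [/\ sprod (U_L x) (tA (val p) x) = 0, sprod (U_R x) (tA (val p) x) = 0,
        sprod (U_L x) (tB (val p) x) = 0 & sprod (U_R x) (tB (val p) x) = 0];
  tilde_span : forall x, Upsilon x ->
    real_span (fun i : bool + (tilde_mixed_pair + tilde_mixed_pair) =>
      match i with
      | inl D => if D then U_L x else U_R x
      | inr (inl p) => tA (val p) x
      | inr (inr p) => tB (val p) x
      end) =
    real_span (fun i : mixed_pair + mixed_pair =>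
      match i with
      | inl p => basisA R (val p).1 (val p).2
      | inr p => basisB R (val p).1 (val p).2
      end);
  tilde_unmixed : forall p : tilde_pair, ~~ mixed (val p) ->
    forall x, Upsilon x ->
      tA (val p) x = basisA R (val p).1 (val p).2 /\
      tB (val p) x = basisB R (val p).1 (val p).2
}.

Definition normal_index := (tilde_pair + tilde_pair + 'I_N.-1)%type.

Lemma card_normal_index :
  (0 < m)%N -> (0 < n)%N -> #|{: normal_index}| = (N ^ 2 - 3)%N.
Proof.
move=> m0 n0; rewrite !card_sum card_ord card_sig.
have mN : (m < N)%N by rewrite -addn1 leq_add2l.
pose p0 : 'I_N * 'I_N := (Ordinal (ltn_trans m0 mN), Ordinal mN).
set c := #|_|.
have lt_card : #|[pred p : 'I_N * 'I_N | (p.1 < p.2)%N]| = c.+1.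
  rewrite (cardD1 p0) inE /= m0 add1n; congr _.+1; apply: eq_card => -[j k].
  by rewrite !inE /= andbC.
have gt_card : #|[pred p : 'I_N * 'I_N | (p.2 < p.1)%N]| = c.+1.
  pose sw (p : 'I_N * 'I_N) : 'I_N * 'I_N := (p.2, p.1).
  have swI : injective sw by move=> [a b] [c' d] [-> ->].
  rewrite -lt_card -(fintype.card_image swI); apply: eq_card => -[j k].
  rewrite -[(j, k)]/(sw (k, j)) fintype.mem_image // !inE.
have diag_card : #|[pred p : 'I_N * 'I_N | p.1 == p.2]| = N.
  have dI : injective (fun a : 'I_N => (a, a)) by move=> a b [].
  rewrite -[RHS]card_ord -(card_codom dI); apply: eq_card => -[j k].
  rewrite !inE /=; apply/eqP/fintype.imageP => [->|[a _ [-> ->]]] //.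
  by exists k.
have tot : #|{: 'I_N * 'I_N}| = (c.+1 + c.+1 + N)%N.
  rewrite -(cardC [pred p : 'I_N * 'I_N | p.1 == p.2]) diag_card addnC.
  congr (_ + _)%N; rewrite -{1}lt_card -gt_card.
  rewrite -[LHS](cardID [pred p : 'I_N * 'I_N | (p.1 < p.2)%N]).
  by congr (_ + _)%N; apply: eq_card => -[j k]; rewrite !inE /= -val_eqE;
    case: ltngtP.
move: tot; rewrite card_prod !card_ord mulnn => ->.
clearbody c; move: (leq_ltn_trans (leq0n m) mN); case: (m + n)%N => // k _.
by rewrite !addSn !addnS !subSS subn0.
Qed.

Definition normal Phi (tA tB : 'I_N * 'I_N -> plane -> 'M[R[i]]_N)
    (i : normal_index) x : 'M[R[i]]_N :=
  Phi x *m match i with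
           | inl (inl p) => tA (val p) x
           | inl (inr p) => tB (val p) x
           | inr p => basisC R p
           end *m (Phi x)^t*.

End Model.

(* Main.v *)
(* Since X^* X = 1, the derivatives of P are off-diagonal with respect to P, so
   the scalar products of d_L Z = [d_L P, P] and d_R Z = - [d_R P, P] reduce to
   traces of dX dX^* P.  The Euler-Lagrange equation and the equality of mixed
   derivatives of Z leave d_L d_R Z = [d_L P, d_R P], which is block diagonal for
   P and hence normal to the surface.

   Conjugation by Phi preserves the scalar product, so the frame inherits the
   orthogonality relations of the tilded matrices; it is complete because a
   traceless matrix orthogonal to it becomes, after conjugation, orthogonal to
   the standard basis of su(N).  Every su(N)-valued derivative therefore expands
   in the frame, its tangential coefficients solving the linear system with Gram
   matrix (J_L, G_LR; G_LR, J_R).  Differentiating (n_j, n_k) = delta_jk and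
   (n_j, d_D Z) = 0 gives the skew symmetry of s and the coefficients alpha and
   beta. *)
Require Import Defs.
From mathcomp Require Import all_boot all_order all_algebra.
From mathcomp Require Import sesquilinear spectral complex.
From mathcomp Require Import ring.
From mathcomp Require Import all_classical all_reals all_analysis.

Set Implicit Arguments.
Unset Strict Implicit.
Unset Printing Implicit Defensive.

Import Order.TTheory GRing.Theory Num.Theory.
Import numFieldNormedType.Exports.

Local Open Scope classical_set_scope.
Local Open Scope ring_scope.
Local Open Scope complex_scope.
Local Open Scope sesquilinear_scope.

(** * Traces and adjoints *)

Lemma mxtraceN (F : nzRingType) n (A : 'M[F]_n) : \tr (- A) = - \tr A.
Proof. exact: raddfN. Qed.

Lemma mxtraceB (F : nzRingType) n (A B : 'M[F]_n) :
  \tr (A - B) = \tr A - \tr B.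
Proof. exact: raddfB. Qed.

Lemma mxtrace_sum (F : nzRingType) (I : finType) n (A : I -> 'M[F]_n) :
  \tr (\sum_i A i) = \sum_i \tr (A i).
Proof.
rewrite /mxtrace exchange_big; apply: eq_bigr => i _ /=.
by rewrite summxE.
Qed.

Lemma adjmxM (C : numClosedFieldType) p q r
    (A : 'M[C]_(p, q)) (B : 'M[C]_(q, r)) :
  (A *m B)^t* = B^t* *m A^t*.
Proof. by rewrite trmx_mul map_mxM. Qed.

Lemma adjmxK (C : numClosedFieldType) p q (A : 'M[C]_(p, q)) : (A^t*)^t* = A.
Proof. by rewrite map_trmx trmxK map_mxCK. Qed.

(** * Differentiation of matrix-valued functions *)

Section MatrixDerivative.
Variable R : realType.
Local Notation plane := (R * R)%type.
Implicit Types (f g : plane -> R[i]) (x v : plane) (U : set plane).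

(** Real and imaginary parts are differentiated separately along real directions, matching [pd];
    existence of both derivatives is part of the claim. *)
Definition is_cderive x v f (d : R[i]) : Prop :=
  is_derive x v (fun y => complex.Re (f y)) (complex.Re d) /\
  is_derive x v (fun y => complex.Im (f y)) (complex.Im d).

Lemma is_cderive_cst x v (c : R[i]) : is_cderive x v (fun=> c) 0.
Proof. by split; exact: is_derive_cst. Qed.

Lemma is_cderiveD x v f g df dg : is_cderive x v f df ->
  is_cderive x v g dg -> is_cderive x v (fun y => f y + g y) (df + dg).
Proof.
move=> [f1 f2] [g1 g2]; split.
  under eq_fun do rewrite raddfD; rewrite raddfD.
  exact: (is_deriveD f1 g1).
under eq_fun do rewrite raddfD; rewrite raddfD.
exact: (is_deriveD f2 g2).
Qed.

Lemma is_cderiveN x v f df :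
  is_cderive x v f df -> is_cderive x v (fun y => - f y) (- df).
Proof.
move=> [f1 f2]; split.
  by under eq_fun do rewrite raddfN; rewrite raddfN; exact: (is_deriveN f1).
by under eq_fun do rewrite raddfN; rewrite raddfN; exact: (is_deriveN f2).
Qed.

Lemma Re_mulc (a b : R[i]) : @complex.Re R (a * b) =
  complex.Re a * complex.Re b - complex.Im a * complex.Im b.
Proof. by case: a b => [? ?] [? ?]. Qed.

Lemma Im_mulc (a b : R[i]) : @complex.Im R (a * b) =
  complex.Re a * complex.Im b + complex.Im a * complex.Re b.
Proof. by case: a b => [? ?] [? ?]. Qed.

Lemma is_cderiveM x v f g df dg : is_cderive x v f df ->
  is_cderive x v g dg ->
  is_cderive x v (fun y => f y * g y) (df * g x + f x * dg).
Proof.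
move=> [f1 f2] [g1 g2]; split.
  under eq_fun do rewrite Re_mulc.
  apply: (is_derive_eq (is_deriveB (is_deriveM f1 g1) (is_deriveM f2 g2))).
  by case: df dg (f x) (g x) {f1 f2 g1 g2} => [? ?] [? ?] [? ?] [? ?] /=;
  rewrite /GRing.scale /=; ring.
under eq_fun do rewrite Im_mulc.
apply: (is_derive_eq (is_deriveD (is_deriveM f1 g2) (is_deriveM f2 g1))).
by case: df dg (f x) (g x) {f1 f2 g1 g2} => [? ?] [? ?] [? ?] [? ?] /=;
  rewrite /GRing.scale /=; ring.
Qed.

Lemma is_cderive_sum x v (I : finType) (F : I -> plane -> R[i])
    (dF : I -> R[i]) : (forall i, is_cderive x v (F i) (dF i)) ->
  is_cderive x v (fun y => \sum_i F i y) (\sum_i dF i).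
Proof.
move=> hF; elim: (index_enum I) => [|i s IHs].
  under eq_fun do rewrite big_nil; rewrite big_nil; exact: is_cderive_cst.
by under eq_fun do rewrite big_cons; rewrite big_cons; exact: is_cderiveD.
Qed.

Lemma Re_conjc (a : R[i]) : @complex.Re R (a^*%R) = complex.Re a.
Proof. by case: a. Qed.

Lemma Im_conjc (a : R[i]) : @complex.Im R (a^*%R) = - complex.Im a.
Proof. by case: a. Qed.

Lemma is_cderive_conj x v f df :
  is_cderive x v f df -> is_cderive x v (fun y => (f y)^*%R) (df^*%R).
Proof.
move=> [f1 f2]; split.
  by rewrite Re_conjc; under eq_fun do rewrite Re_conjc.
rewrite Im_conjc; under eq_fun do rewrite Im_conjc.
exact: (is_deriveN f2).
Qed.

Lemma is_cderive_near x v f g df : (\near x, f x = g x) ->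
  is_cderive x v f df -> is_cderive x v g df.
Proof.
move=> fg [f1 f2].
by split; [apply: near_eq_is_derive f1|apply: near_eq_is_derive f2];
  apply: filterS fg => y ->.
Qed.

Lemma is_cderive_unique x v f d1 d2 :
  is_cderive x v f d1 -> is_cderive x v f d2 -> d1 = d2.
Proof.
move=> [a1 b1] [a2 b2]; case: d1 d2 a1 b1 a2 b2 => [? ?] [? ?] /= [_ <-] [_ <-].
by move=> [_ <-] [_ <-].
Qed.

(* pd is total, with a junk value where a partial derivative does not exist;
   is_pd also asserts that it exists. *)
Definition is_pd p q (D : bool) (F : plane -> 'M[R[i]]_(p, q)) x
    (dF : 'M[R[i]]_(p, q)) : Prop :=
  forall i j, is_cderive x (lc_dir R D) (fun y => F y i j) (dF i j).

Section Rules.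
Variables (D : bool) (x : plane).

Lemma is_pdE p q (F : plane -> 'M[R[i]]_(p, q)) dF :
  is_pd D F x dF -> pd D F x = dF.
Proof.
move=> h; apply/matrixP => i j; rewrite mxE.
by have [[_ ->] [_ ->]] := h i j; case: (dF i j).
Qed.

Lemma is_pd_cst p q (A : 'M[R[i]]_(p, q)) : is_pd D (fun=> A) x 0.
Proof. by move=> i j; rewrite mxE; exact: is_cderive_cst. Qed.

Lemma is_pdD p q (F G : plane -> 'M[R[i]]_(p, q)) dF dG :
  is_pd D F x dF -> is_pd D G x dG -> is_pd D (fun y => F y + G y) x (dF + dG).
Proof.
move=> hF hG i j; rewrite mxE; under eq_fun do rewrite mxE.
exact: is_cderiveD.
Qed.

Lemma is_pdN p q (F : plane -> 'M[R[i]]_(p, q)) dF :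
  is_pd D F x dF -> is_pd D (fun y => - F y) x (- dF).
Proof.
move=> hF i j; rewrite mxE; under eq_fun do rewrite mxE.
exact: is_cderiveN.
Qed.

Lemma is_pdB p q (F G : plane -> 'M[R[i]]_(p, q)) dF dG :
  is_pd D F x dF -> is_pd D G x dG -> is_pd D (fun y => F y - G y) x (dF - dG).
Proof. by move=> hF hG; apply: is_pdD => //; exact: is_pdN. Qed.

Lemma is_pdM p q r (F : plane -> 'M[R[i]]_(p, q)) (G : plane -> 'M[R[i]]_(q, r))
    dF dG : is_pd D F x dF -> is_pd D G x dG ->
  is_pd D (fun y => F y *m G y) x (dF *m G x + F x *m dG).
Proof.
move=> hF hG i j; rewrite !mxE -big_split /=; under eq_fun do rewrite mxE.
by apply: is_cderive_sum => k; exact: is_cderiveM.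
Qed.

Lemma is_pd_adj p q (F : plane -> 'M[R[i]]_(p, q)) dF :
  is_pd D F x dF -> is_pd D (fun y => (F y)^t*) x (dF^t*).
Proof.
move=> hF i j; rewrite !mxE; under eq_fun do rewrite !mxE.
exact: is_cderive_conj.
Qed.

Lemma is_pd_near p q (F G : plane -> 'M[R[i]]_(p, q)) dF :
  (\near x, F x = G x) -> is_pd D F x dF -> is_pd D G x dF.
Proof.
move=> FG hF i j; apply: is_cderive_near (hF i j).
by apply: filterS FG => y ->.
Qed.

Lemma is_cderive_sprod N (F G : plane -> 'M[R[i]]_N) dF dG :
  is_pd D F x dF -> is_pd D G x dG ->
  is_cderive x (lc_dir R D) (fun y => sprod (F y) (G y))
    (sprod dF (G x) + sprod (F x) dG).
Proof.
move=> hF hG; rewrite /sprod -mulrDr -mxtraceD.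
(* The factor -1/2 is treated as a function with derivative 0, so the zero term added here gives the
   goal the shape of the product rule. *)
rewrite -[X in is_cderive _ _ _ X]add0r -[X in X + _](mul0r (\tr (F x *m G x))).
apply: is_cderiveM; first exact: is_cderive_cst.
by apply: is_cderive_sum => i; exact: (is_pdM hF hG).
Qed.

Lemma is_pd_pd p q (F : plane -> 'M[R[i]]_(p, q)) dF :
  is_pd D F x dF -> is_pd D F x (pd D F x).
Proof. by move=> hF; rewrite (is_pdE hF). Qed.

End Rules.

Lemma smooth_is_pd U p q (F : plane -> 'M[R[i]]_(p, q)) D x :
  smooth_mx U F -> U x -> is_pd D F x (pd D F x).
Proof.
(* Level 1 of [Ck] already contains differentiability. *)
move=> hF Ux i j; have [/(_ 1) [+ _] /(_ 1) [+ _]] := hF i j.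
move=> /(_ x Ux) hR /(_ x Ux) hI; rewrite mxE.
by split; apply: derivableP; exact: diff_derivable.
Qed.

Lemma smooth_pd U p q (F : plane -> 'M[R[i]]_(p, q)) D :
  smooth_mx U F -> smooth_mx U (pd D F).
Proof.
move=> hF i j; have [hR hI] := hF i j.
by split=> k; under eq_fun do rewrite mxE /=;
  [exact: (hR k.+1).2|exact: (hI k.+1).2].
Qed.

End MatrixDerivative.

(** * Symmetry of second directional derivatives *)

Section SecondDerivatives.
Variables (R : realType) (V : normedModType R).
Implicit Types (f : V -> R) (x u v : V) (U : set V).

(** The difference quotient of the restriction to the line is literally that of [f] in direction
    [v], so existence and value transfer together. *)
Lemma is_derive_line f v y (h : R) : derivable f (h *: v + y) v ->
  is_derive h 1 (fun s => f (s *: v + y)) ('D_v f (h *: v + y)).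
Proof.
move=> df.
have E :
    (fun k : R => k^-1 *:
       (((fun s => f (s *: v + y)) \o shift h) (k *: 1) - f (h *: v + y))) =
    (fun k => k^-1 *:
       ((f \o shift (h *: v + y)) (k *: v) - f (h *: v + y))).
  by apply/funext => k /=; rewrite [k *: 1]mulr1 scalerDl addrA.
by apply: DeriveDef; rewrite /derivable /derive E.
Qed.

Lemma MVT_line f v y (t : R) : 0 < t ->
  (forall s, 0 <= s <= t -> derivable f (s *: v + y) v) ->
  exists2 s, 0 <= s <= t &
    f (t *: v + y) - f y = 'D_v f (s *: v + y) * t.
Proof.
move=> t0 df.
have dl (s : R) : s \in `[0, t]%R ->
    is_derive s 1 (fun s => f (s *: v + y)) ('D_v f (s *: v + y)).
  by rewrite in_itv /= => st; apply: is_derive_line; exact: df.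
pose g := fun s : R => f (s *: v + y).
pose dg := fun s : R => 'D_v f (s *: v + y).
have dg_in (s : R) : s \in `]0, t[%R -> is_derive s 1 g (dg s).
  rewrite in_itv /= => /andP[/ltW s0 /ltW st].
  by apply: dl; rewrite in_itv /= s0.
have cg : {within `[0, t], continuous g}.
  by apply: derivable_within_continuous => s /dl [].
have [s st] := MVT t0 dg_in cg.
rewrite /g scale0r add0r subr0 => ->.
by exists s => //; move: st; rewrite in_itv /= => /andP[/ltW -> /ltW ->].
Qed.

(** The mean value theorem is applied twice: along [u] to an increment of [f] in direction [v], then
    along [v] to ['D_u f]. *)
Lemma second_difference f U u v x (t : R) : 0 < t ->
  (forall a b, 0 <= a <= t -> 0 <= b <= t -> U (a *: u + (b *: v + x))) ->
  (forall y, U y -> derivable f y u /\ derivable ('D_u f) y v) ->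
  exists a b : R, [/\ 0 <= a <= t, 0 <= b <= t &
    f (t *: u + (t *: v + x)) - f (t *: v + x) - (f (t *: u + x) - f x) =
    'D_v ('D_u f) (a *: u + (b *: v + x)) * (t * t)].
Proof.
move=> t0 hU df.
have t_ge0 : 0 <= t <= t by rewrite lexx ltW.
have z_ge0 : 0 <= (0 : R) <= t by rewrite lexx ltW.
have lower a : 0 <= a <= t -> U (a *: u + x).
  by move=> at_; have := hU a 0 at_ z_ge0; rewrite scale0r add0r.
have [a at_ Ea] : exists2 s, 0 <= s <= t &
    f (t *: u + (t *: v + x)) - f (t *: v + x) - (f (t *: u + x) - f x)
    = ('D_u f (s *: u + (t *: v + x)) - 'D_u f (s *: u + x)) * t.
  (* The second difference of [f] is the increment of [g] from [x] to [t *: u + x]. *)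
  pose g y := f (y + t *: v) - f y.
  have dg s : 0 <= s <= t -> is_derive (s *: u + x) u g
      ('D_u f (s *: u + x + t *: v) - 'D_u f (s *: u + x)).
    move=> st; apply: is_deriveB.
    - have := (df _ (hU s t st t_ge0)).1; rewrite (addrC (t *: v)) addrA => d.
      have E :
          (fun k : R => k^-1 *:
             (((fun y => f (y + t *: v)) \o shift (s *: u + x)) (k *: u)
              - f (s *: u + x + t *: v))) =
          (fun k => k^-1 *:
             ((f \o shift (s *: u + x + t *: v)) (k *: u)
              - f (s *: u + x + t *: v))).
        by apply/funext => k /=; rewrite !addrA.
      by apply: DeriveDef; rewrite /derivable /derive E.
    - by apply: derivableP; exact: (df _ (lower _ st)).1.
  have [s st E] := MVT_line t0 (fun s st => @ex_derive _ _ _ _ _ _ _ (dg s st)).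
  exists s => //; move: E; rewrite /g (@derive_val _ _ _ _ _ _ _ (dg s st)).
  by rewrite (addrC (t *: v) x) !(addrA (_ *: u)) => <-; ring.
rewrite {}Ea.
have dv s : 0 <= s <= t -> derivable ('D_u f) (s *: v + (a *: u + x)) v.
  by move=> st; rewrite addrCA; exact: (df _ (hU _ _ at_ st)).2.
have [b bt] := MVT_line t0 dv; rewrite !(addrCA (_ *: v)) => ->.
by exists a, b; rewrite mulrA.
Qed.

(** Triangle inequality through the common value [c = d]. In the application [a], [b] are the two
    mixed derivatives at [x], and [c], [d] those at the two intermediate points. *)
Lemma dist_lt_split (a b c d e : R) :
  c = d -> `|a - c| < e / 2 -> `|b - d| < e / 2 -> `|a - b| < e.
Proof.
move=> -> ac bc; rewrite (splitr e) (le_lt_trans (ler_distD d _ _)) //.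
by rewrite ltrD // distrC.
Qed.

(* The second difference is symmetric in u and v, and applying the mean value
   theorem in either order evaluates it by one of the two mixed derivatives. *)
Lemma derive_swap f U u v x : open U -> U x ->
  (forall y, U y -> [/\ derivable f y u, derivable f y v,
     derivable ('D_u f) y v & derivable ('D_v f) y u]) ->
  {for x, continuous ('D_v ('D_u f))} -> {for x, continuous ('D_u ('D_v f))} ->
  'D_v ('D_u f) x = 'D_u ('D_v f) x.
Proof.
move=> oU Ux df cvu cuv; apply/eqP; rewrite -subr_eq0 -normr_le0.
apply/ler_addgt0Pl => e e0; rewrite addr0.
have e20 : 0 < e / 2 by rewrite divr_gt0.
pose W := [set y | [/\ U y, `|'D_v ('D_u f) x - 'D_v ('D_u f) y| < e / 2 &
                   `|'D_u ('D_v f) x - 'D_u ('D_v f) y| < e / 2]].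
have nU : nbhs x U by exact: open_nbhs_nbhs.
have nvu : \forall y \near x, `|'D_v ('D_u f) x - 'D_v ('D_u f) y| < e / 2.
  by move/cvgrPdist_lt : cvu => /(_ _ e20).
have nuv : \forall y \near x, `|'D_u ('D_v f) x - 'D_u ('D_v f) y| < e / 2.
  by move/cvgrPdist_lt : cuv => /(_ _ e20).
have : nbhs x W by apply: filterS3 nU nvu nuv => y; split.
move=> /nbhs_ballP[r /= r0 ballW].
(* With this [t] the closed parallelogram of sides [t *: u], [t *: v] at [x] lies in the ball of
   radius [r]; the summand 1 makes the bound strict and covers [u = v = 0]. *)
pose t := r / (`|u| + `|v| + 1).
have d0 : 0 < `|u| + `|v| + 1 by rewrite ltr_wpDl ?addr_ge0.
have t0 : 0 < t by rewrite divr_gt0.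
have hW a b : 0 <= a <= t -> 0 <= b <= t -> W (a *: u + (b *: v + x)).
  move=> /andP[a0 at_] /andP[b0 bt]; apply: ballW; rewrite -ball_normE /=.
  rewrite addrA opprD addrCA subrr addr0 normrN.
  apply: (@le_lt_trans _ _ (t * (`|u| + `|v|))).
    rewrite (le_trans (ler_normD _ _))// !normrZ !ger0_norm// mulrDr.
    by rewrite lerD// ler_wpM2r.
  by rewrite /t -mulrA gtr_pMr// mulrC ltr_pdivrMr// mul1r ltrDl.
have [a [b [at_ bt E1]]] := second_difference t0 hW
  (fun y Wy => let: And4 d1 _ d2 _ := df y (let: And3 Uy _ _ := Wy in Uy) in
               conj d1 d2).
have hW' a' b' : 0 <= a' <= t -> 0 <= b' <= t -> W (a' *: v + (b' *: u + x)).
  by move=> h1 h2; rewrite addrCA; exact: hW.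
have [b' [a' [bt' at_' E2]]] := second_difference t0 hW'
  (fun y Wy => let: And4 _ d1 _ d2 := df y (let: And3 Uy _ _ := Wy in Uy) in
               conj d1 d2).
(* Both values times [t * t] equal the same second difference, and [t * t] is nonzero. *)
have E : 'D_v ('D_u f) (a *: u + (b *: v + x)) =
         'D_u ('D_v f) (b' *: v + (a' *: u + x)).
  have subAC (k l p q : R) : k - l - (p - q) = k - p - (l - q) by ring.
  have Ex : t *: v + (t *: u + x) = t *: u + (t *: v + x) by exact: addrCA.
  apply: (@mulIf _ (t * t)); first by rewrite mulf_neq0 ?gt_eqF.
  rewrite Ex in E2; apply: (etrans (esym E1)); apply: etrans E2.
  exact: subAC.
have [_ h1 _] := hW _ _ at_ bt; have [_ _ h2] := hW' _ _ bt' at_'.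
exact/ltW/(dist_lt_split E h1 h2).
Qed.

End SecondDerivatives.

Section MixedPartials.
Variable R : realType.

Lemma pd_swap U p q (F : R * R -> 'M[R[i]]_(p, q)) x : open U ->
  smooth_mx U F -> U x -> pd L_ (pd R_ F) x = pd R_ (pd L_ F) x.
Proof.
move=> oU hF Ux; apply/matrixP => i j; rewrite [LHS]mxE [RHS]mxE.
have swap (g : R * R -> R) : smooth U g ->
    'D_(lc_dir R L_) ('D_(lc_dir R R_) g) x =
    'D_(lc_dir R R_) ('D_(lc_dir R L_) g) x.
  (* Level 2 of [Ck] supplies differentiability of [g] and of its directional derivatives, and
     continuity of the second ones. *)
  move=> hg; have [d1 hd] := hg 2; apply: (derive_swap oU Ux) => [y Uy||].
  - by split; apply: diff_derivable; [exact: d1|exact: d1|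
      exact: (hd _).1|exact: (hd _).1].
  - exact: ((hd _).2 _ x Ux).
  - exact: ((hd _).2 _ x Ux).
have ReE D : (fun y => complex.Re (pd D F y i j)) =
    'D_(lc_dir R D) (fun y => complex.Re (F y i j)).
  by apply/funext => y; rewrite mxE.
have ImE D : (fun y => complex.Im (pd D F y i j)) =
    'D_(lc_dir R D) (fun y => complex.Im (F y i j)).
  by apply/funext => y; rewrite mxE.
by have [hR hI] := hF i j; rewrite !ReE !ImE (swap _ hR) (swap _ hI).
Qed.

End MixedPartials.

(** * The orthonormal basis of su(N) *)

Section ScalarProduct.
Variables (R : realType) (N : nat).
Implicit Types A B M U : 'M[R[i]]_N.

Lemma sprodC A B : sprod A B = sprod B A.
Proof. by rewrite /sprod mxtrace_mulC. Qed.

Lemma sprodDr A B M : sprod M (A + B) = sprod M A + sprod M B.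
Proof. by rewrite /sprod mulmxDr mxtraceD mulrDr. Qed.

Lemma sprodZr c A B : sprod A (c *: B) = c * sprod A B.
Proof. by rewrite /sprod -scalemxAr mxtraceZ mulrCA. Qed.

Lemma sprodZZ a b A B : sprod (a *: A) (b *: B) = a * b * sprod A B.
Proof. by rewrite sprodZr sprodC sprodZr sprodC mulrA (mulrC b). Qed.

Lemma sprod0r A : sprod A 0 = 0.
Proof. by rewrite /sprod mulmx0 mxtrace0 mulr0. Qed.

Lemma sprodNr A B : sprod A (- B) = - sprod A B.
Proof. by rewrite -scaleN1r sprodZr mulN1r. Qed.

Lemma sprodBr A B M : sprod M (A - B) = sprod M A - sprod M B.
Proof. by rewrite sprodDr sprodNr. Qed.

Lemma sprod_sumr (I : finType) M (F : I -> 'M[R[i]]_N) :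
  sprod M (\sum_i F i) = \sum_i sprod M (F i).
Proof.
elim: (index_enum I) => [|i s IHs]; first by rewrite !big_nil sprod0r.
by rewrite !big_cons sprodDr IHs.
Qed.

(** Through this lemma the equality of spans [tilde_span] transfers orthogonality from one
    generating family to the other. *)
Lemma sprod_real_span0 (I : finType) (F : I -> 'M[R[i]]_N) M A :
  (forall i, sprod M (F i) = 0) -> real_span F A -> sprod M A = 0.
Proof.
move=> MF [c ->]; rewrite sprod_sumr big1 // => i _.
by rewrite sprodZr MF mulr0.
Qed.

Lemma mem_real_span (I : finType) (F : I -> 'M[R[i]]_N) i : real_span F (F i).
Proof.
exists (fun j => (j == i)%:R); rewrite (bigD1 i) //= big1 => [|j /negPf ->].
  by rewrite eqxx addr0 rmorph1 scale1r.
by rewrite rmorph0 scale0r.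
Qed.

Lemma SU_adjM U : SU U -> U^t* *m U = 1%:M.
Proof. by case=> /unitarymxP /mulmx1C. Qed.

Lemma sprod_conj U A B : SU U ->
  sprod (U *m A *m U^t*) (U *m B *m U^t*) = sprod A B.
Proof.
move=> /SU_adjM UU; rewrite /sprod mxtrace_mulC !mulmxA.
rewrite -(mulmxA _ _ U) UU mulmx1 mxtrace_mulC !mulmxA UU mul1mx.
by rewrite mxtrace_mulC.
Qed.

Lemma sprod_conjr U A B :
  sprod A (U *m B *m U^t*) = sprod (U^t* *m A *m U) B.
Proof.
by rewrite /sprod !mulmxA mxtrace_mulC !mulmxA.
Qed.

(** The adjoint of [A *m B] is [B *m A], so by cyclicity the trace is its own conjugate. This makes
    the frame coefficients real although [sprod] is complex-valued. *)
Lemma su_sprod_real A B : A^t* = - A -> B^t* = - B ->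
  (complex.Re (sprod A B))%:C = sprod A B.
Proof.
move=> hA hB; apply: RRe_real; apply/CrealP.
rewrite /sprod rmorphM /= rmorphN fmorphV rmorphMn rmorph1; congr (_ * _).
have adjE : (\tr (A *m B))^*%R = \tr ((A *m B)^t*).
  by rewrite trace_map_mx mxtrace_tr.
by rewrite adjE trmx_mul map_mxM hA hB mulNmx mulmxN opprK mxtrace_mulC.
Qed.

End ScalarProduct.

(** * Orthonormality and completeness of the standard basis *)

Section Basis.
Variables (R : realType) (N : nat).
Implicit Types (M : 'M[R[i]]_N) (j k a b : 'I_N) (p q : 'I_N.-1).

Lemma mxtrace_deltaM j k M : \tr (delta_mx j k *m M) = M k j.
Proof.
rewrite -(mul_delta_mx (ord0 : 'I_1)) -mulmxA mxtrace_mulC -rowE -colE.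
by rewrite /mxtrace big_ord1 !mxE.
Qed.

Lemma sprod_basisA j k M :
  sprod (basisA R j k) M = - 2^-1 * ('i%C * (M j k + M k j)).
Proof.
have -> : basisA R j k = 'i%C *: (delta_mx j k + delta_mx k j).
  apply/matrixP => a b; rewrite !mxE !(eq_sym a) !(eq_sym b).
  by rewrite (andbC (j == b)).
rewrite /sprod -scalemxAl mxtraceZ mulmxDl mxtraceD !mxtrace_deltaM.
by rewrite (addrC (M k j)).
Qed.

Lemma sprod_basisB j k M :
  sprod (basisB R j k) M = 2^-1 * (M j k - M k j).
Proof.
have -> : basisB R j k = delta_mx j k - delta_mx k j.
  apply/matrixP => a b; rewrite !mxE !(eq_sym a) !(eq_sym b).
  by rewrite (andbC (j == b)).
rewrite /sprod mulmxBl raddfB /= !mxtrace_deltaM.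
by rewrite mulNr -mulrN opprB.
Qed.

(** The diagonal of [basisC] without its normalization: 1 up to position [p], then [- p.+1], then 0.
    Natural-number arguments avoid ordinal casts at position [p.+1]. *)
Definition basisC_weight (p a : nat) : R[i] :=
  (a <= p)%:R - p.+1%:R * (p.+1 == a)%:R.

Definition basisC_scale (p : nat) : R[i] :=
  'i%C * (Num.sqrt (2 / (p.+1%:R * p.+2%:R)))%:C.

(** The inner sum of [basisC] has a nonzero term only on the diagonal, and there exactly when
    [a <= p]. *)
Lemma basisCE p a b :
  basisC R p a b = basisC_scale p * (basisC_weight p a *+ (a == b)).
Proof.
rewrite mxE -/(basisC_scale p); congr (_ * _); have [<-|ab] := eqVneq a b.
  rewrite mulr1n andbb /basisC_weight; congr (_ - _).
  under eq_bigr do rewrite andbb.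
  have [ap|pa] := leqP a p.
    rewrite (bigD1 (Ordinal (ap : (a < p.+1)%N))) //= eqxx big1 ?addr0 // => d.
    by rewrite -val_eqE /= => /negPf ->.
  rewrite big1 // => d _; rewrite (_ : (d == a :> nat) = false) //.
  by apply/negbTE; rewrite neq_ltn (leq_trans (ltn_ord d)).
rewrite mulr0n big1 => [|d _]; last first.
  by case: eqP => // ->; rewrite val_eqE (negPf ab).
by case: eqP => [->|]; rewrite /= ?val_eqE ?(negPf ab) mulr0 subr0.
Qed.

Lemma sprod_basisC p M : sprod (basisC R p) M =
  - 2^-1 * (basisC_scale p * \sum_(a < N) basisC_weight p a * M a a).
Proof.
rewrite /sprod; congr (_ * _); rewrite mulr_sumr; apply: eq_bigr => a _.
rewrite mxE (bigD1 a) //= big1 => [|b ba]; last first.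
  by rewrite basisCE (eq_sym a) (negPf ba) mulr0n mulr0 mul0r.
by rewrite addr0 basisCE eqxx mulr1n mulrA.
Qed.

Lemma sum_leq_ord (p : nat) : (p < N)%N ->
  \sum_(a < N) ((a <= p)%:R : R[i]) = p.+1%:R.
Proof.
move=> pN; rewrite -natr_sum; congr _%:R.
under eq_bigr do rewrite -ltnS.
rewrite (eq_bigr (fun a : 'I_N => if (a < p.+1)%N then 1%N else 0%N)).
  by rewrite -big_mkcond -(big_ord_widen _ (fun=> 1%N)) // sum1_card card_ord.
by move=> a _; case: ifP.
Qed.

Lemma sum_basisC_weight_eq (p : nat) (d : 'I_N -> R[i]) (pN : (p.+1 < N)%N) :
  \sum_(a < N) basisC_weight p a * d a =
  \sum_(a < N) (a <= p)%:R * d a - p.+1%:R * d (Ordinal pN).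
Proof.
under eq_bigr do rewrite mulrBl.
rewrite sumrB; congr (_ - _); rewrite (bigD1 (Ordinal pN)) //= eqxx mulr1.
rewrite big1 ?addr0 // => a; rewrite -val_eqE /= eq_sym => /negPf ->.
by rewrite mulr0 mul0r.
Qed.

Lemma ltn_pred_ord p : (p.+1 < N)%N.
Proof. by have := ltn_ord p; case: N p => // N' p; rewrite ltnS. Qed.

Lemma sum_basisC_weight (p : nat) :
  (p.+1 < N)%N -> \sum_(a < N) basisC_weight p a = 0.
Proof.
move=> pN; under eq_bigr do rewrite -[basisC_weight _ _]mulr1.
rewrite (sum_basisC_weight_eq (fun=> 1) pN) mulr1.
under eq_bigr do rewrite mulr1.
by rewrite sum_leq_ord ?subrr // ltnW.
Qed.

(** On the support [a <= p.+1 <= q] of the first weight the second weight is 1. Orthogonality of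
    distinct [basisC] thus reduces to tracelessness. *)
Lemma basisC_weight_lt (p q a : nat) : (p < q)%N ->
  basisC_weight p a * basisC_weight q a = basisC_weight p a.
Proof.
move=> pq; have [aq|qa] := leqP a q.
  by rewrite {2}/basisC_weight aq gtn_eqF ?ltnS // mulr0 subr0 mulr1.
have pa : (p.+1 < a)%N by exact: leq_ltn_trans qa.
by rewrite /basisC_weight leqNgt (ltnW pa) ltn_eqF // mulr0 subr0 mul0r.
Qed.

Lemma sum_basisC_weightM p q : (p < q)%N ->
  \sum_(a < N) basisC_weight p a * basisC_weight q a = 0.
Proof.
move=> pq; under eq_bigr do rewrite basisC_weight_lt //.
by rewrite sum_basisC_weight ?ltn_pred_ord.
Qed.

(** There are [p.+1] ones and a single entry of square [p.+1 ^ 2]. *)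
Lemma sum_basisC_weight_sqr p :
  \sum_(a < N) basisC_weight p a * basisC_weight p a = p.+1%:R * p.+2%:R.
Proof.
rewrite (sum_basisC_weight_eq (fun a : 'I_N => basisC_weight p a)
          (ltn_pred_ord p)).
rewrite (eq_bigr (fun a : 'I_N => (a <= p)%:R)) => [|a _]; last first.
  rewrite /basisC_weight; case: leqP => [ap|]; rewrite ?mul0r // mul1r.
  by rewrite gtn_eqF // mulr0 subr0.
rewrite sum_leq_ord ?(ltnW (ltn_pred_ord p)) // /basisC_weight /= ltnn eqxx.
by rewrite mulr1 sub0r mulrN opprK -[X in X + _]mulr1 -mulrDr nat1r.
Qed.

(** The square of the imaginary unit cancels the sign of the scalar product, and its factor 1/2
    cancels the 2 under the root. *)
Lemma basisC_scale_sqr (p : nat) : - 2^-1 * (basisC_scale p * basisC_scale p) =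
  (p.+1%:R * p.+2%:R)^-1.
Proof.
rewrite /basisC_scale mulrACA.
rewrite (_ : 'i%C * 'i%C = -1); last by rewrite -expr2 sqr_i.
rewrite mulN1r mulrNN.
rewrite -rmorphM /= -expr2 sqr_sqrtr; last first.
  by rewrite divr_ge0 ?mulr_ge0 ?ler0n.
rewrite rmorphM /= fmorphV rmorphM /= !rmorph_nat.
by rewrite mulrA mulVf ?mul1r // pnatr_eq0.
Qed.

Lemma sprod_basisCC p q : sprod (basisC R p) (basisC R q) = (p == q)%:R.
Proof.
wlog: p q / (p <= q)%N.
  move=> hw; have [pq|/ltnW qp] := leqP p q; first exact: hw.
  by rewrite sprodC hw // eq_sym.
rewrite leq_eqVlt sprod_basisC => pq.
under eq_bigr do rewrite basisCE eqxx mulr1n mulrCA.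
rewrite -mulr_sumr; case/predU1P: pq => [/val_inj <-|pq].
  rewrite sum_basisC_weight_sqr (mulrA (basisC_scale p)) [LHS]mulrA.
  by rewrite basisC_scale_sqr eqxx mulVf.
by rewrite sum_basisC_weightM // !mulr0 -val_eqE ltn_eqF.
Qed.

(** Excludes the crossed Kronecker term in the products of the [basisA] and [basisB] matrices. *)
Lemma ltn_pair_swap j k j' k' : (j < k)%N -> (j' < k')%N ->
  (j' == k) && (k' == j) = false.
Proof.
move=> jk jk'; apply/negP => /andP[/eqP j'k /eqP k'j].
by move: jk'; rewrite j'k k'j ltnNge ltnW.
Qed.

Lemma sprod_basisAA j k j' k' : (j < k)%N -> (j' < k')%N ->
  sprod (basisA R j k) (basisA R j' k') = ((j == j') && (k == k'))%:R.
Proof.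
move=> jk jk'; rewrite sprod_basisA !mxE (ltn_pair_swap jk jk').
rewrite (eq_sym j) (eq_sym k); set b : R[i] := _%:R.
rewrite addr0 add0r -mulrDr mulrA.
rewrite (_ : 'i%C * 'i%C = -1); last by rewrite -expr2 sqr_i.
by field.
Qed.

Lemma sprod_basisAB j k j' k' : sprod (basisA R j k) (basisB R j' k') = 0.
Proof. by rewrite sprod_basisA !mxE addrA subrK subrr !mulr0. Qed.

Lemma sprod_basisBB j k j' k' : (j < k)%N -> (j' < k')%N ->
  sprod (basisB R j k) (basisB R j' k') = ((j == j') && (k == k'))%:R.
Proof.
move=> jk jk'; rewrite sprod_basisB !mxE (ltn_pair_swap jk jk').
rewrite (eq_sym j) (eq_sym k).
by set b : R[i] := _%:R; rewrite subr0 sub0r opprK; field.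
Qed.

Lemma sprod_basisAC j k p : (j < k)%N -> sprod (basisA R j k) (basisC R p) = 0.
Proof.
move=> jk; rewrite sprod_basisA !basisCE (eq_sym k) -val_eqE ltn_eqF //.
by rewrite mulr0n mulr0 addr0 !mulr0.
Qed.

Lemma sprod_basisBC j k p : (j < k)%N -> sprod (basisB R j k) (basisC R p) = 0.
Proof.
move=> jk; rewrite sprod_basisB !basisCE (eq_sym k) -val_eqE ltn_eqF //.
by rewrite mulr0n mulr0 subr0 !mulr0.
Qed.

(* The basis of su(N) spans all traceless matrices over the complex numbers, so
   M need not be anti-Hermitian. *)
Lemma basis_complete M : \tr M = 0 ->
  (forall j k, (j < k)%N -> sprod (basisA R j k) M = 0) ->
  (forall j k, (j < k)%N -> sprod (basisB R j k) M = 0) ->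
  (forall p, sprod (basisC R p) M = 0) -> M = 0.
Proof.
move=> trM hA hB hC.
(* The products with [basisA] and [basisB] give the sum and the difference of the entries [M j k]
   and [M k j]. *)
have offdiag j k : (j < k)%N -> M j k = 0 /\ M k j = 0.
  move=> jk; have /eqP := hA _ _ jk; have /eqP := hB _ _ jk.
  rewrite sprod_basisA sprod_basisB !mulf_eq0 oppr_eq0 invr_eq0 pnatr_eq0 /=.
  rewrite (_ : 'i%C == 0 = false) /=; last first.
    by rewrite eq_complex /= oner_eq0 andbF.
  rewrite subr_eq0 => /eqP ->.
  by rewrite -mulr2n mulrn_eq0 /= => /eqP ->.
have basisC_scale_neq0 (p : nat) : basisC_scale p != 0.
  apply/eqP => c0; have /esym/eqP := basisC_scale_sqr p.
  by rewrite c0 !mulr0 invr_eq0 mulf_eq0 !pnatr_eq0.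
(* For [N = 0] there is no index 0 to start the induction from, but then every matrix vanishes. *)
have [N0|[z z0]] : N = 0%N \/ exists z : 'I_N, z = 0%N :> nat.
- by case: (N) => [|N']; [left|right; exists ord0].
- by apply/matrixP => a; have := ltn_ord a; rewrite {2}N0.
(* Orthogonality to the [n]-th [basisC] says that the first [n.+1] diagonal entries sum to [n.+1]
   times the next one; as they all equal [M z z], so does the next. *)
have diag n a : (a <= n)%N -> M a a = M z z.
  elim: n a => [|n IHn] a.
    by rewrite leqn0 -z0 => /eqP /val_inj ->.
  rewrite leq_eqVlt => /predU1P[an|/IHn //].
  have nN : (n.+1 < N)%N by rewrite -an.
  have nN' : (n < N.-1)%N by move: nN; case: (N).
  have -> : a = Ordinal nN by exact: val_inj.
  have /eqP := hC (Ordinal nN'); rewrite sprod_basisC mulf_eq0 oppr_eq0.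
  rewrite invr_eq0 pnatr_eq0 mulf_eq0 (negPf (basisC_scale_neq0 _)) /=.
  rewrite (sum_basisC_weight_eq (fun a => M a a) nN) subr_eq0.
  rewrite (eq_bigr (fun b : 'I_N => (b <= n)%:R * M z z)) => [|b _]; last first.
    by case: leqP => [/IHn -> //|_]; rewrite !mul0r.
  rewrite -mulr_suml sum_leq_ord ?(ltnW nN) // => /eqP E.
  by apply: (@mulfI _ n.+1%:R); rewrite ?pnatr_eq0 // -E.
have Mz : M z z = 0.
  move: trM; rewrite /mxtrace (eq_bigr (fun=> M z z)) => [|a _].
    rewrite sumr_const card_ord => /eqP.
    rewrite mulrn_eq0 => /predU1P[N0|/eqP //].
    by have := ltn_ord z; rewrite {2}N0.
  exact: diag.
apply/matrixP => a b; rewrite [RHS]mxE.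
case: (ltngtP a b) => [ab|ba|/val_inj <-].
- by case: (offdiag _ _ ab).
- by case: (offdiag _ _ ba).
- by rewrite (diag a).
Qed.

End Basis.

(** * The projector and the surface *)

Section ProjectorAlgebra.
Variables (R : realType) (N m : nat).
Variables (X : 'M[R[i]]_(N, m)) (X' : 'M[R[i]]_(m, N)).
Hypothesis X'X : X' *m X = 1%:M.
Variable P : 'M[R[i]]_N.
Hypothesis defP : P = 1%:M - X *m X'.

Lemma cproj_mulX : P *m X = 0.
Proof. by rewrite defP mulmxBl mul1mx -mulmxA X'X mulmx1 subrr. Qed.

Lemma cproj_Xmul : X' *m P = 0.
Proof. by rewrite defP mulmxBr mulmx1 mulmxA X'X mul1mx subrr. Qed.

Lemma cproj_idem : P *m P = P.
Proof. by rewrite {1}defP mulmxBl mul1mx -mulmxA cproj_Xmul mulmx0 subr0. Qed.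

(** Here [Y] plays the role of a derivative of [X], primes those of adjoints, and the first argument
    of [comm] that of the derivative of [P]. The other terms die by [P *m X = 0] and
    [X' *m P = 0]. *)
Lemma comm_dproj (Y : 'M[R[i]]_(N, m)) (Y' : 'M[R[i]]_(m, N)) :
  comm (- (Y *m X' + X *m Y')) P = P *m Y *m X' - X *m Y' *m P.
Proof.
rewrite /comm mulmxN mulNmx opprK mulmxDl mulmxDr !mulmxA.
rewrite cproj_mulX mul0mx addr0.
by rewrite -(mulmxA Y) cproj_Xmul mulmx0 add0r addrC.
Qed.

(** The hypothesis is the derivative of [X' *m X = 1]. The two sides differ by [X (X' Y + Y' X) X'],
    which it annihilates. *)
Lemma dproj_offdiag (Y : 'M[R[i]]_(N, m)) (Y' : 'M[R[i]]_(m, N))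
    (C := - (Y *m X' + X *m Y')) :
  X' *m Y + Y' *m X = 0 -> P *m C + C *m P = C.
Proof.
move=> tangent; rewrite /C mulmxN mulNmx -opprD; congr (- _).
rewrite mulmxDl mulmxDr !mulmxA cproj_mulX mul0mx addr0.
rewrite -(mulmxA Y) cproj_Xmul mulmx0 add0r {1}defP mulmxBl mul1mx.
rewrite defP mulmxBr mulmx1 mulmxBl !mulmxA addrACA -opprD.
rewrite -(mulmxA X X') -(mulmxA X Y') -mulmxDl -mulmxDr tangent.
by rewrite mulmx0 mul0mx subr0.
Qed.

(** The two products of like terms vanish because [X' *m P = 0] and [P *m X = 0]; the mixed ones
    simplify by cyclicity, [X' *m X = 1] and [P *m P = P]. *)
Lemma sprod_tangent (Y W : 'M[R[i]]_(N, m)) (Y' W' : 'M[R[i]]_(m, N)) :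
  sprod (P *m Y *m X' - X *m Y' *m P) (P *m W *m X' - X *m W' *m P) =
  2^-1 * \tr ((Y *m W' + W *m Y') *m P).
Proof.
rewrite /sprod mulNr -mulrN -mxtraceN; congr (_ * _).
rewrite mulmxBl !mulmxBr.
have -> : P *m Y *m X' *m (P *m W *m X') = 0.
  by rewrite !mulmxA -(mulmxA _ X') cproj_Xmul mulmx0 !mul0mx.
have -> : X *m Y' *m P *m (X *m W' *m P) = 0.
  by rewrite !mulmxA -(mulmxA _ P) cproj_mulX mulmx0 !mul0mx.
rewrite sub0r subr0 -opprD opprK mulmxDl !mxtraceD.
congr (_ + _).
  rewrite !mulmxA -(mulmxA _ X') X'X mulmx1 mxtrace_mulC !mulmxA cproj_idem.
  by rewrite -mulmxA mxtrace_mulC.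
rewrite !mulmxA -(mulmxA _ P P) cproj_idem mxtrace_mulC !mulmxA X'X mul1mx.
by rewrite mxtrace_mulC mulmxA.
Qed.

(** Off-diagonality of [C] gives [P C P = 0], which kills two of the four traces. [A] stays
    arbitrary so that it can be a second derivative of the projector. *)
Lemma sprod_comm_offdiag (A C : 'M[R[i]]_N) : P *m C + C *m P = C ->
  sprod (comm A P) (comm C P) = 2^-1 * \tr (A *m C).
Proof.
move=> offC; have PCP : P *m C *m P = 0.
  have /(congr1 (mulmx P)) := offC; rewrite mulmxDr mulmxA cproj_idem => /eqP.
  by rewrite -subr_eq0 addrAC subrr add0r mulmxA => /eqP.
rewrite /sprod /comm mulNr -mulrN -mxtraceN; congr (_ * _).
rewrite mulmxBl !mulmxBr.
have -> : A *m P *m (C *m P) = 0.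
  by rewrite -mulmxA (mulmxA P) PCP mulmx0.
have tr0 : \tr (P *m A *m (P *m C)) = 0.
  by rewrite -mulmxA mxtrace_mulC -!mulmxA (mulmxA P) PCP mulmx0 mxtrace0.
rewrite sub0r !(mxtraceN, mxtraceB) tr0 subr0 -opprD opprK -[in RHS]offC.
rewrite mulmxDr mxtraceD; congr (_ + _).
  by rewrite -mulmxA (mulmxA P P) cproj_idem.
by rewrite -mulmxA mxtrace_mulC -!mulmxA cproj_idem.
Qed.

(* [A, C] commutes with P when A and C are off-diagonal. *)
Lemma sprod_comm_comm (A C E : 'M[R[i]]_N) :
  P *m A + A *m P = A -> P *m C + C *m P = C -> sprod (comm A C) (comm E P) = 0.
Proof.
move=> offA offC.
have swap (B D : 'M[R[i]]_N) : P *m B + B *m P = B -> P *m D + D *m P = D ->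
    P *m (B *m D) = B *m D *m P.
  move=> offB offD; apply: (@addIr _ (B *m P *m D)).
  by rewrite mulmxA -mulmxDl offB -!mulmxA -mulmxDr addrC offD.
have comP : P *m comm A C = comm A C *m P.
  by rewrite /comm mulmxBr mulmxBl (swap A C) // (swap C A).
rewrite /sprod {2}/comm mulmxBr mxtraceB mulmxA mxtrace_mulC mulmxA comP.
by rewrite !mulmxA subrr mulr0.
Qed.

(** With [A] a repeated second derivative of [X] and [S] the product of the first derivative with
    its adjoint, the left factor is minus the second derivative of the projector. Tangency turns the
    terms in [A] and [A'] into traces against [P]. *)
Lemma mxtrace_ddproj_dproj (Y A : 'M[R[i]]_(N, m)) (Y' A' : 'M[R[i]]_(m, N))
    (S : 'M[R[i]]_N) :
  X' *m Y + Y' *m X = 0 ->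
  \tr ((A *m X' + 2 *: S + X *m A') *m (Y *m X' + X *m Y')) =
  \tr ((A *m Y' + Y *m A') *m P + 2 *: (S *m (X *m Y' + Y *m X'))).
Proof.
move=> tangent; have X'Y : X' *m Y = - (Y' *m X).
  by apply/eqP; rewrite -addr_eq0 tangent.
have Y'X : Y' *m X = - (X' *m Y) by rewrite X'Y opprK.
rewrite !mulmxDl !mulmxDr -!scalemxAl !mxtraceD !mxtraceZ.
have -> : \tr (A *m X' *m (Y *m X')) + \tr (A *m X' *m (X *m Y')) =
    \tr (A *m Y' *m P).
  rewrite defP mulmxBr mulmx1 mxtraceB addrC; congr (_ + _).
    by rewrite !mulmxA -(mulmxA A) X'X mulmx1.
  by rewrite !mulmxA -(mulmxA A) X'Y mulmxN mulNmx mxtraceN !mulmxA.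
have -> : \tr (X *m A' *m (Y *m X')) + \tr (X *m A' *m (X *m Y')) =
    \tr (Y *m A' *m P).
  rewrite defP mulmxBr mulmx1 mxtraceB; congr (_ + _).
    by rewrite mxtrace_mulC -!mulmxA (mulmxA X') X'X mul1mx.
  rewrite mxtrace_mulC -!mulmxA (mulmxA Y') Y'X mulNmx mulmxN mxtraceN.
  by rewrite -!mulmxA (mulmxA X X') mxtrace_mulC -!mulmxA.
ring.
Qed.

End ProjectorAlgebra.

(** * Derivatives of the projector and of the surface *)

Section ProjectorDerivatives.
Variables (R : realType) (m n : nat).
Local Notation N := (m + n)%N.
Local Notation plane := (R * R)%type.
Local Notation proj := Defs.proj.
Variables (Omega : set plane) (X : plane -> 'M[R[i]]_(N, m)).
Hypotheses (openO : open Omega) (solX : sigma_solution Omega X).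
Implicit Types (B D : bool) (x : plane).

Lemma near_open (U : set plane) x : open U -> U x -> \forall y \near x, U y.
Proof. by move=> oU Ux; exact: open_nbhs_nbhs. Qed.

Let smoothX : smooth_mx Omega X.
Proof. by case: solX. Qed.
Let adjX_X x : Omega x -> (X x)^t* *m X x = 1%:M.
Proof. by case: solX => _ + _; apply. Qed.

Lemma pdadjE D x : Omega x -> pdadj X D x = (pd D X x)^t*.
Proof.
move=> Ox; apply: is_pdE; apply: is_pd_adj.
exact: (smooth_is_pd D smoothX Ox).
Qed.

Lemma pd_pdadjE B D x : Omega x -> pd B (pdadj X D) x = (pd B (pd D X) x)^t*.
Proof.
move=> Ox; apply: is_pdE.
apply: (@is_pd_near _ _ _ _ _ (fun y => (pd D X y)^t*)).
  by apply: filterS (near_open openO Ox) => y Oy; rewrite pdadjE.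
by apply: is_pd_adj; exact: (smooth_is_pd B (smooth_pd D smoothX) Ox).
Qed.

(** Obtained by differentiating [X^* X = 1], which holds near [x] because [Omega] is open. *)
Lemma tangentX D x : Omega x ->
  (X x)^t* *m pd D X x + (pd D X x)^t* *m X x = 0.
Proof.
move=> Ox; have dX := smooth_is_pd D smoothX Ox.
have dXX := is_pdM (is_pd_adj dX) dX.
rewrite addrC -(is_pdE dXX); apply: is_pdE.
apply: is_pd_near (is_pd_cst D x 1%:M).
by apply: filterS (near_open openO Ox) => y Oy; rewrite adjX_X.
Qed.

Lemma is_pd_proj D x : Omega x ->
  is_pd D (proj X) x (- (pd D X x *m (X x)^t* + X x *m (pd D X x)^t*)).
Proof.
move=> Ox; rewrite -[X in is_pd _ _ _ X]sub0r.
apply: is_pdB; first exact: is_pd_cst.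
by apply: is_pdM; [|apply: is_pd_adj]; exact: (smooth_is_pd D smoothX Ox).
Qed.

Lemma pd_projE D x : Omega x ->
  pd D (proj X) x = - (pd D X x *m (X x)^t* + X x *m (pd D X x)^t*).
Proof. by move=> Ox; apply: is_pdE; exact: is_pd_proj. Qed.

Lemma is_pd_pd_proj B D x : Omega x ->
  is_pd B (pd D (proj X)) x
    (- ((pd B (pd D X) x *m (X x)^t* + pd D X x *m (pd B X x)^t*)
        + (pd B X x *m (pd D X x)^t* + X x *m (pd B (pd D X) x)^t*))).
Proof.
move=> Ox; apply: (@is_pd_near _ _ _ _ _
  (fun y => - (pd D X y *m (X y)^t* + X y *m (pd D X y)^t*))).
  by apply: filterS (near_open openO Ox) => y Oy; rewrite pd_projE.
have dX := smooth_is_pd B smoothX Ox.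
have ddX := smooth_is_pd B (smooth_pd D smoothX) Ox.
by apply: is_pdN; apply: is_pdD; apply: is_pdM => //; exact: is_pd_adj.
Qed.

Lemma proj_offdiag D x : Omega x ->
  proj X x *m pd D (proj X) x + pd D (proj X) x *m proj X x = pd D (proj X) x.
Proof.
move=> Ox; rewrite pd_projE //.
exact: (dproj_offdiag (adjX_X Ox) erefl (tangentX D Ox)).
Qed.

Lemma pd_comm_proj D x : Omega x -> comm (pd D (proj X) x) (proj X x) =
  proj X x *m pd D X x *m (X x)^t* - X x *m (pd D X x)^t* *m proj X x.
Proof.
move=> Ox; rewrite (pd_projE D Ox); exact: (@comm_dproj _ _ _ (X x) ((X x)^t*)
  (adjX_X Ox) (proj X x) erefl (pd D X x) ((pd D X x)^t*)).
Qed.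

Variable Z : plane -> 'M[R[i]]_N.
Hypothesis surfZ : associated_surface Omega X Z.

Let smoothZ : smooth_mx Omega Z. Proof. by case: surfZ. Qed.

(** The sign by which the equations for [pd L_ Z] and [pd R_ Z] differ, so that both directions are
    treated at once. *)
Definition lc_sign D : R[i] := if D then 1 else -1.

Lemma pd_surface D x : Omega x ->
  pd D Z x = lc_sign D *: comm (pd D (proj X) x) (proj X x).
Proof.
case: surfZ => _ _ hL hR Ox; case: D; rewrite /lc_sign.
  by rewrite scale1r hL.
by rewrite scaleN1r hR.
Qed.

Lemma pd_pd_surface B D x : Omega x -> pd B (pd D Z) x =
  lc_sign D *: (comm (pd B (pd D (proj X)) x) (proj X x)
                + comm (pd D (proj X) x) (pd B (proj X) x)).
Proof.
(* The sign is written as a scalar matrix so that the matrix product rule covers it. *)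
move=> Ox; apply: is_pdE; apply: (@is_pd_near _ _ _ _ _
  (fun y => (lc_sign D)%:M *m comm (pd D (proj X) y) (proj X y))).
  apply: filterS (near_open openO Ox) => y Oy.
  by rewrite mul_scalar_mx pd_surface.
have dP := is_pd_pd (is_pd_proj B Ox).
have ddP := is_pd_pd (is_pd_pd_proj B D Ox).
have := is_pdM (is_pd_cst B x (lc_sign D)%:M)
  (is_pdB (is_pdM ddP dP) (is_pdM dP ddP)).
by rewrite mul0mx add0r mul_scalar_mx [X in _ - X]addrC opprD addrACA.
Qed.

Lemma sprod_pd_surface B D x : Omega x -> sprod (pd B Z x) (pd D Z x) =
  lc_sign B * lc_sign D * (2^-1 *
   \tr ((pd B X x *m (pd D X x)^t* + pd D X x *m (pd B X x)^t*) *m proj X x)).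
Proof.
move=> Ox.
have E := etrans (congr2 (@sprod R N) (pd_comm_proj B Ox) (pd_comm_proj D Ox))
  (@sprod_tangent _ _ _ (X x) ((X x)^t*) (adjX_X Ox) (proj X x) erefl
     (pd B X x) (pd D X x) ((pd B X x)^t*) ((pd D X x)^t*)).
by rewrite (pd_surface B Ox) (pd_surface D Ox) sprodZZ E.
Qed.

Lemma sprod_pd_surface_diag D x :
  Omega x -> sprod (pd D Z x) (pd D Z x) = J X D x.
Proof.
move=> Ox; rewrite sprod_pd_surface // /J pdadjE // mulmxDl mxtraceD.
have -> : lc_sign D * lc_sign D = 1 by case: D; rewrite /lc_sign ?mulrNN mulr1.
by set t : R[i] := \tr _; field.
Qed.

Lemma sprod_pd_surface_LR x :
  Omega x -> sprod (pd L_ Z x) (pd R_ Z x) = GLR X x.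
Proof.
move=> Ox; rewrite sprod_pd_surface // /GLR !pdadjE // /lc_sign mul1r mulN1r.
by rewrite -mulNr.
Qed.

(** For a repeated direction the commutator of the two first derivatives of the projector vanishes,
    leaving [[d_B d_B P, P]] against the off-diagonal [d_D P]. *)
Lemma sprod_pd_pd_surface B D x : Omega x ->
  sprod (pd B (pd B Z) x) (pd D Z x) = ddZ_dZ X B D x.
Proof.
move=> Ox; rewrite pd_pd_surface // /comm subrr addr0 -/(comm _ _).
rewrite [pd D Z x]pd_surface // sprodZr sprodC sprodZr sprodC mulrA.
rewrite (sprod_comm_offdiag (adjX_X Ox) erefl _ (proj_offdiag D Ox)).
rewrite /ddZ_dZ pd_pdadjE // !pdadjE // mulrA; congr (_ * _).
  (* The two signs times 1/2 give the prefactor [(B == D) - 1/2] of [ddZ_dZ]. *)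
  by case: B; case: D; rewrite /lc_sign /=; field.
rewrite (is_pdE (is_pd_pd_proj B B Ox)) pd_projE // mulNmx mulmxN opprK.
rewrite -(mxtrace_ddproj_dproj (adjX_X Ox) erefl _ _ _ (tangentX D Ox)).
by congr (\tr (_ *m _)); rewrite scaler_nat mulr2n !addrA.
Qed.

Lemma pd_LR_surface x : Omega x ->
  pd L_ (pd R_ Z) x = comm (pd L_ (proj X) x) (pd R_ (proj X) x).
Proof.
move=> Ox; rewrite pd_pd_surface // /lc_sign scaleN1r.
by case: solX => _ _ -> //; rewrite add0r /comm opprB.
Qed.

Lemma sprod_pd_LR_surface D x : Omega x ->
  sprod (pd L_ (pd R_ Z) x) (pd D Z x) = 0.
Proof.
move=> Ox; rewrite pd_LR_surface // pd_surface // sprodZr.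
have := @sprod_comm_comm _ _ (proj X x) (pd L_ (proj X) x) (pd R_ (proj X) x)
  (pd D (proj X) x) (proj_offdiag _ Ox) (proj_offdiag _ Ox).
by move=> ->; rewrite mulr0.
Qed.

End ProjectorDerivatives.

(** * The moving frame *)

Section SuDerivative.
Variables (R : realType) (N : nat).
Implicit Types (A U : 'M[R[i]]_N) (j k : 'I_N).

(** Both equations defining su(N) are real-linear, hence can be differentiated. *)
Lemma su_is_pd (D : bool) (F : R * R -> 'M[R[i]]_N) x dF :
  is_pd D F x dF -> (\near x, su (F x)) -> su dF.
Proof.
move=> hF suF; split.
  rewrite -(is_pdE (is_pd_adj hF)); apply: is_pdE.
  apply: is_pd_near (is_pdN hF); apply: filterS suF => y [-> _] //.
have h : is_cderive x (lc_dir R D) (fun y => \tr (F y)) (\tr dF).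
  by apply: is_cderive_sum => i; exact: hF.
apply: (is_cderive_unique h); apply: is_cderive_near (is_cderive_cst _ _ 0).
by apply: filterS suF => y [_ ->].
Qed.

Lemma su_conj U A : SU U -> su A -> su (U *m A *m U^t*).
Proof.
move=> hU [hA trA]; split; last first.
  by rewrite mxtrace_mulC mulmxA SU_adjM // mul1mx.
by rewrite !adjmxM adjmxK hA mulNmx mulmxN mulmxA.
Qed.

(** A boolean flag lets the A and B families share one proof; [tildeAB] below uses the same
    convention. *)
Definition basisAB (b : bool) j k : 'M[R[i]]_N :=
  if b then basisA R j k else basisB R j k.

Lemma sprod_basisAB_AB b b' j k j' k' : (j < k)%N -> (j' < k')%N ->
  sprod (basisAB b j k) (basisAB b' j' k') =
  [&& b == b', j == j' & k == k']%:R.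
Proof.
move=> jk jk'; case: b; case: b' => /=.
- exact: sprod_basisAA.
- exact: sprod_basisAB.
- by rewrite sprodC sprod_basisAB.
- exact: sprod_basisBB.
Qed.

Lemma sprod_basisAB_C b j k p : (j < k)%N ->
  sprod (basisAB b j k) (basisC R p) = 0.
Proof. by case: b => jk; [exact: sprod_basisAC|exact: sprod_basisBC]. Qed.

Lemma su_basisAB b j k : (j < k)%N -> su (basisAB b j k).
Proof.
move=> jk; have njk : (j == k) = false by rewrite -val_eqE ltn_eqF.
case: b; split.
- apply/matrixP => a c; rewrite !mxE rmorphM rmorphD !rmorph_nat /=.
  rewrite addrC (andbC (j == c)) (andbC (j == a)) -mulNr; congr (_ * _).
  by apply/eqP; rewrite eq_complex /= oppr0 !eqxx.
- rewrite /mxtrace big1 // => a _; rewrite mxE (andbC (j == a)) -mulr2n.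
  by case: eqP => [<-|]; rewrite ?(eq_sym k) ?njk ?mul0rn mulr0.
- apply/matrixP => a c; rewrite !mxE rmorphB !rmorph_nat opprB.
  by rewrite (andbC (j == c)) (andbC (j == a)).
- by rewrite /mxtrace big1 // => a _; rewrite mxE subrr.
Qed.

Lemma su_basisC (p : 'I_N.-1) : su (basisC R p).
Proof.
split.
  apply/matrixP => a c; rewrite [LHS]mxE [in LHS]mxE [RHS]mxE !basisCE.
  rewrite rmorphM /= -mulNr eq_sym; congr (_ * _).
    rewrite /basisC_scale rmorphM /= -mulNr; congr (_ * _).
      by apply/eqP; rewrite eq_complex /= oppr0 !eqxx.
    by apply/eqP; rewrite eq_complex /= oppr0 !eqxx.
  case: eqP => [->|_]; last by rewrite !mulr0n rmorph0.
  by rewrite !mulr1n /basisC_weight rmorphB rmorphM !rmorph_nat.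
rewrite /mxtrace.
rewrite (eq_bigr (fun a : 'I_N => basisC_scale R p * basisC_weight R p a)).
  by rewrite -mulr_sumr sum_basisC_weight ?mulr0 ?ltn_pred_ord.
by move=> a _; rewrite basisCE eqxx.
Qed.

End SuDerivative.

(** * Orthogonality and completeness of the tilded matrices *)

Section Frame.
Variables (R : realType) (m n : nat).
Hypothesis m_gt0 : (0 < m)%N.
Local Notation N := (m + n)%N.
Local Notation plane := (R * R)%type.
Variables (Upsilon : set plane) (U_L U_R : plane -> 'M[R[i]]_N).
Variables (tA tB : 'I_N * 'I_N -> plane -> 'M[R[i]]_N).
Hypothesis tilde : tilde_matrices Upsilon U_L U_R tA tB.

Definition tildeAB (b : bool) := if b then tA else tB.

Definition tilde_normal (i : normal_index m n) x : 'M[R[i]]_N :=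
  match i with
  | inl (inl p) => tA (val p) x
  | inl (inr p) => tB (val p) x
  | inr p => basisC R p
  end.

Lemma normal_tildeE Phi i x :
  normal Phi tA tB i x = Phi x *m tilde_normal i x *m (Phi x)^t*.
Proof. by case: i => [[]|]. Qed.

(** By [tilde_span], the listed matrices lie in the real span of the mixed standard ones. Applied
    below to unmixed basis matrices and to [basisC]. *)
Lemma sprod_mixed0 M x : Upsilon x ->
  (forall b (p : mixed_pair m n),
     sprod M (basisAB R b (val p).1 (val p).2) = 0) ->
  [/\ sprod M (U_L x) = 0, sprod M (U_R x) = 0 &
      forall b (p : tilde_mixed_pair m n), sprod M (tildeAB b (val p) x) = 0].
Proof.
move=> Ux hM; have hspan := tilde_span tilde Ux.
have M0 A : real_span (fun i : mixed_pair m n + mixed_pair m n =>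
      match i with
      | inl p => basisA R (val p).1 (val p).2
      | inr p => basisB R (val p).1 (val p).2
      end) A -> sprod M A = 0.
  by apply: sprod_real_span0 => -[p|p]; [exact: (hM true)|exact: (hM false)].
split; [apply: M0|apply: M0|case=> p; apply: M0]; rewrite -hspan.
- exact: (mem_real_span _ (inl true)).
- exact: (mem_real_span _ (inl false)).
- exact: (mem_real_span _ (inr (inl p))).
- exact: (mem_real_span _ (inr (inr p))).
Qed.

Lemma mixed_lt (p : 'I_N * 'I_N) : mixed p -> (p.1 < p.2)%N.
Proof. by case/andP => /leq_trans; apply. Qed.

Lemma missing_mixed (p : 'I_N * 'I_N) : missing p -> mixed p.
Proof. by case/andP => /eqP p1 /eqP p2; rewrite /mixed p1 p2 m_gt0 leqnn. Qed.

(** The basic case split: either the Gram-Schmidt conditions govern the pair, or its matrices are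
    standard basis matrices. *)
Lemma tilde_pairP (p : tilde_pair m n) :
  (exists q : tilde_mixed_pair m n, val q = val p) \/ ~~ mixed (val p).
Proof.
have [mp|] := boolP (mixed (val p)); [left|by right].
have nm : mixed (val p) && ~~ missing (val p).
  by rewrite mp; case/andP: (valP p).
by exists (exist _ (val p) nm).
Qed.

Lemma tilde_pair_lt (p : tilde_pair m n) : ((val p).1 < (val p).2)%N.
Proof. by case/andP: (valP p). Qed.

Lemma tilde_unmixedE b (p : tilde_pair m n) x : ~~ mixed (val p) -> Upsilon x ->
  tildeAB b (val p) x = basisAB R b (val p).1 (val p).2.
Proof.
by move=> np Ux; have [] := tilde_unmixed tilde np Ux; case: b.
Qed.

Lemma sprod_unmixed0 b (p : tilde_pair m n) x : ~~ mixed (val p) -> Upsilon x ->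
  forall b' (q : mixed_pair m n),
  sprod (tildeAB b (val p) x) (basisAB R b' (val q).1 (val q).2) = 0.
Proof.
move=> np Ux b' q; rewrite tilde_unmixedE // sprod_basisAB_AB ?tilde_pair_lt //;
  last by rewrite mixed_lt // (valP q).
case: eqP => //= _; case: eqP => //= E1; case: eqP => //= E2.
by case/negP: np; rewrite /mixed E1 E2; exact: (valP q).
Qed.

Lemma sprod_C_mixed0 (p : 'I_N.-1) b' (q : mixed_pair m n) :
  sprod (basisC R p) (basisAB R b' (val q).1 (val q).2) = 0.
Proof. by rewrite sprodC sprod_basisAB_C // mixed_lt // (valP q). Qed.

Lemma sprod_tildeAB b b' (p q : tilde_pair m n) x : Upsilon x ->
  sprod (tildeAB b (val p) x) (tildeAB b' (val q) x) =
  ((b == b') && (p == q))%:R.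
Proof.
move=> Ux; have [[p' p'E]|np] := tilde_pairP p;
  have [[q' q'E]|nq] := tilde_pairP q.
- rewrite -p'E -q'E -[p == q]val_eqE -p'E -q'E val_eqE.
  have [AA BB AB] := tilde_orthonormal tilde p' q' Ux.
  have [_ _ BA] := tilde_orthonormal tilde q' p' Ux.
  by case: b; case: b' => //=; rewrite sprodC.
- have [_ _ /(_ b p')] := sprod_mixed0 Ux (sprod_unmixed0 b' nq Ux).
  (* Here [p] is mixed and [q] is not, so the Kronecker symbol is 0 as well. *)
  rewrite sprodC -p'E => ->; case: (p =P q) => [pq|]; last by rewrite andbF.
  by case/negP: nq; rewrite -pq -p'E; case/andP: (valP p').
- have [_ _ /(_ b' q')] := sprod_mixed0 Ux (sprod_unmixed0 b np Ux).
  rewrite -q'E => ->; case: (p =P q) => [pq|]; last by rewrite andbF.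
  by case/negP: np; rewrite pq -q'E; case/andP: (valP q').
- by rewrite !tilde_unmixedE // sprod_basisAB_AB ?tilde_pair_lt.
Qed.

Lemma sprod_tildeAB_C b (p : tilde_pair m n) q x : Upsilon x ->
  sprod (tildeAB b (val p) x) (basisC R q) = 0.
Proof.
move=> Ux; have [[p' <-]|np] := tilde_pairP p.
  by rewrite sprodC; have [_ _ /(_ b p')] := sprod_mixed0 Ux (sprod_C_mixed0 q).
by rewrite tilde_unmixedE // sprod_basisAB_C // tilde_pair_lt.
Qed.

Lemma sprod_tilde_normal i j x : Upsilon x ->
  sprod (tilde_normal i x) (tilde_normal j x) = (i == j)%:R.
Proof.
move=> Ux; case: i => [[p|p]|p]; case: j => [[q|q]|q] /=.
- exact: (sprod_tildeAB true true).
- exact: (sprod_tildeAB true false).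
- exact: (sprod_tildeAB_C true).
- exact: (sprod_tildeAB false true).
- exact: (sprod_tildeAB false false).
- exact: (sprod_tildeAB_C false).
- by rewrite sprodC; exact: (sprod_tildeAB_C true).
- by rewrite sprodC; exact: (sprod_tildeAB_C false).
- exact: sprod_basisCC.
Qed.

Lemma sprod_U_tilde_normal i x : Upsilon x ->
  sprod (U_L x) (tilde_normal i x) = 0 /\ sprod (U_R x) (tilde_normal i x) = 0.
Proof.
move=> Ux.
have AB b (p : tilde_pair m n) : sprod (U_L x) (tildeAB b (val p) x) = 0 /\
    sprod (U_R x) (tildeAB b (val p) x) = 0.
  have [[p' <-]|np] := tilde_pairP p.
    by have [? ? ? ?] := tilde_orthogonal tilde p' Ux; case: b.
  have [hL hR _] := sprod_mixed0 Ux (sprod_unmixed0 b np Ux).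
  by rewrite !(sprodC _ (tildeAB _ _ _)).
case: i => [[p|p]|p] /=; [exact: (AB true)|exact: (AB false)|].
have [hL hR _] := sprod_mixed0 Ux (sprod_C_mixed0 p).
by rewrite !(sprodC _ (basisC _ _)).
Qed.

(** Equality of spans converts orthogonality to [U_L], [U_R] and the mixed tilded matrices into
    orthogonality to every mixed standard matrix, including those at the missing pair. The remaining
    basis elements are themselves normals, so [basis_complete] applies. *)
Lemma tilde_complete M x : Upsilon x -> \tr M = 0 ->
  sprod M (U_L x) = 0 -> sprod M (U_R x) = 0 ->
  (forall i, sprod M (tilde_normal i x) = 0) -> M = 0.
Proof.
move=> Ux trM ML MR Mn.
have Mt b (q : tilde_mixed_pair m n) : sprod M (tildeAB b (val q) x) = 0.
  have tq : ((val q).1 < (val q).2)%N && ~~ missing (val q).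
    by case/andP: (valP q) => /mixed_lt -> ->.
  case: b; first exact: (Mn (inl (inl (exist _ (val q) tq)))).
  exact: (Mn (inl (inr (exist _ (val q) tq)))).
have span0 A : real_span (fun i : mixed_pair m n + mixed_pair m n =>
      match i with
      | inl p => basisA R (val p).1 (val p).2
      | inr p => basisB R (val p).1 (val p).2
      end) A -> sprod M A = 0.
  rewrite -(tilde_span tilde Ux); apply: sprod_real_span0.
  by move=> [[]|[p|p]] //; [exact: (Mt true)|exact: (Mt false)].
have Mmixed b (p : mixed_pair m n) :
    sprod M (basisAB R b (val p).1 (val p).2) = 0.
  case: b; apply: span0; first exact: (mem_real_span _ (inl p)).
  exact: (mem_real_span _ (inr p)).
have MAB b (j k : 'I_N) : (j < k)%N -> sprod M (basisAB R b j k) = 0.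
  move=> jk; have [mx|nmx] := boolP (mixed (j, k)).
    exact: (Mmixed b (exist _ (j, k) mx)).
  (* The missing pair is mixed, so an unmixed pair always carries tilded matrices. *)
  have tp : (j < k)%N && ~~ missing (j, k).
    by rewrite jk; apply: contra nmx; exact: missing_mixed.
  rewrite -(tilde_unmixedE b (p := exist _ (j, k) tp) nmx Ux).
  case: b; first exact: (Mn (inl (inl (exist _ (j, k) tp)))).
  exact: (Mn (inl (inr (exist _ (j, k) tp)))).
apply: basis_complete => // [j k jk|j k jk|p].
- by rewrite sprodC; exact: (MAB true).
- by rewrite sprodC; exact: (MAB false).
- by rewrite sprodC; exact: (Mn (inr p)).
Qed.

End Frame.

(** * Differentiability of the tilded matrices *)

Section TildeDerivatives.
Variables (R : realType) (m n : nat).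
Local Notation N := (m + n)%N.
Local Notation plane := (R * R)%type.
Variables (Upsilon : set plane) (U_L U_R : plane -> 'M[R[i]]_N).
Variables (tA tB : 'I_N * 'I_N -> plane -> 'M[R[i]]_N).
Hypothesis openU : open Upsilon.
Hypothesis tilde : tilde_matrices Upsilon U_L U_R tA tB.

Lemma su_tilde_normal (i : normal_index m n) x :
  Upsilon x -> su (tilde_normal tA tB i x).
Proof.
move=> Ux.
have AB b (p : tilde_pair m n) : su (tildeAB tA tB b (val p) x).
  have [[p' <-]|np] := tilde_pairP p.
    by have [? ?] := tilde_su tilde p' Ux; case: b.
  by rewrite (tilde_unmixedE tilde) //; apply: su_basisAB; exact: tilde_pair_lt.
case: i => [[p|p]|p]; [exact: (AB true)|exact: (AB false)|exact: su_basisC].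
Qed.

Lemma is_pd_tilde_normal D (i : normal_index m n) x : Upsilon x ->
  exists dF, is_pd D (tilde_normal tA tB i) x dF.
Proof.
move=> Ux.
have AB b (p : tilde_pair m n) :
    exists dF, is_pd D (tildeAB tA tB b (val p)) x dF.
  have [[p' <-]|np] := tilde_pairP p.
    have [sA sB] := tilde_smooth tilde p'.
    case: b; eexists; first exact: (smooth_is_pd D sA Ux).
    exact: (smooth_is_pd D sB Ux).
  (* An unmixed tilded matrix is known to be constant only on [Upsilon]; openness makes it locally
     constant. *)
  exists 0; apply: is_pd_near (is_pd_cst D x (basisAB R b (val p).1 (val p).2)).
  apply: filterS (near_open openU Ux) => y Uy.
  by rewrite (tilde_unmixedE tilde).
case: i => [[p|p]|p]; [exact: (AB true)|exact: (AB false)|].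
by exists 0; exact: is_pd_cst.
Qed.

End TildeDerivatives.

(** * Frame expansion by Cramer's rule for the tangential Gram matrix *)

Lemma gram_solve (F : fieldType) (jl jr g vl vr : F) : jl * jr - g ^+ 2 != 0 ->
  (jr * vl - g * vr) / (jl * jr - g ^+ 2) * jl +
    (jl * vr - g * vl) / (jl * jr - g ^+ 2) * g = vl /\
  (jr * vl - g * vr) / (jl * jr - g ^+ 2) * g +
    (jl * vr - g * vl) / (jl * jr - g ^+ 2) * jr = vr.
Proof. by move=> d; split; field. Qed.

(** Serves the mixed derivative of [Z], whose tangential products both vanish. *)
Lemma gram_combination0 (R : realType) N (jl jr g d vl vr : R[i])
    (zl zr s : 'M[R[i]]_N) : vl = 0 -> vr = 0 ->
  ((jr * vl - g * vr) / d) *: zl + ((jl * vr - g * vl) / d) *: zr + s = s.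
Proof. by move=> -> ->; rewrite !mulr0 subrr mul0r !scale0r !add0r. Qed.

(** Serves the derivatives of the normals: Cramer's coefficients take the form of alpha and beta,
    with [p] and [q] the normal components of second derivatives of [Z]. *)
Lemma gram_combinationN (R : realType) N (jl jr g d vl vr p q : R[i])
    (zl zr s : 'M[R[i]]_N) : vl = - p -> vr = - q ->
  ((jr * vl - g * vr) / d) *: zl + ((jl * vr - g * vl) / d) *: zr + s =
  ((q * g - p * jr) / d) *: zl + ((p * g - q * jl) / d) *: zr + s.
Proof.
move=> -> ->; congr (_ / _ *: _ + _ / _ *: _ + _); first by ring.
by ring.
Qed.

Section FrameRemainder.
Variables (R : realType) (N : nat) (I : finType).
Variables (zl zr v : 'M[R[i]]_N) (f : I -> 'M[R[i]]_N) (jl jr g : R[i]).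
Hypotheses (zll : sprod zl zl = jl) (zlr : sprod zl zr = g).
Hypothesis zrr : sprod zr zr = jr.
Hypothesis zlf : forall i, sprod zl (f i) = 0.
Hypothesis zrf : forall i, sprod zr (f i) = 0.
Hypothesis ff : forall i j, sprod (f i) (f j) = (i == j)%:R.
Hypothesis det_neq0 : jl * jr - g ^+ 2 != 0.

Definition frame_expansion : 'M[R[i]]_N :=
  ((jr * sprod v zl - g * sprod v zr) / (jl * jr - g ^+ 2)) *: zl
  + ((jl * sprod v zr - g * sprod v zl) / (jl * jr - g ^+ 2)) *: zr
  + \sum_i sprod v (f i) *: f i.

(** Cramer's rule matches the products with [zl] and [zr], orthonormality those with the [f i]. That
    the remainder itself vanishes needs completeness, supplied later. *)
Lemma sprod_frame_remainder :
  [/\ sprod (v - frame_expansion) zl = 0, sprod (v - frame_expansion) zr = 0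
    & forall i, sprod (v - frame_expansion) (f i) = 0].
Proof.
have [Ea Eb] := gram_solve (sprod v zl) (sprod v zr) det_neq0.
have sum0 z : (forall i, sprod z (f i) = 0) ->
    sprod z (\sum_i sprod v (f i) *: f i) = 0.
  by move=> zf; rewrite sprod_sumr big1 // => i _; rewrite sprodZr zf mulr0.
split; [| |move=> i]; rewrite sprodC sprodBr !sprodDr !sprodZr.
- by rewrite (sum0 zl) // addr0 zll zlr Ea sprodC subrr.
- by rewrite (sum0 zr) // addr0 zrr (sprodC zr zl) zlr Eb sprodC subrr.
- rewrite (sprodC (f i) zl) (sprodC (f i) zr) zlf zrf !mulr0 !add0r.
  rewrite sprod_sumr (bigD1 i) //=.
  rewrite big1 => [|j ji]; last by rewrite sprodZr ff eq_sym (negPf ji) mulr0.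
  by rewrite sprodZr ff eqxx mulr1 addr0 sprodC subrr.
Qed.

Lemma tr_frame_remainder : \tr v = 0 -> \tr zl = 0 -> \tr zr = 0 ->
  (forall i, \tr (f i) = 0) -> \tr (v - frame_expansion) = 0.
Proof.
move=> tv tzl tzr tf.
rewrite mxtraceB tv !mxtraceD !mxtraceZ tzl tzr !mulr0 !add0r.
rewrite mxtrace_sum big1 ?oppr0 // => i _.
by rewrite mxtraceZ tf mulr0.
Qed.

End FrameRemainder.

(** * Normalization and Gauss-Weingarten equations of the moving frame *)

Theorem proposition1 (R : realType) (m n : nat) (hm : (1 <= m)%N) (hn : (1 <= n)%N)
  (Omega : set (R * R)) (hOpen : open Omega) (hConn : connected Omega)
  (hSimply : simply_connected Omega)
  (X : R * R -> 'M[R[i]]_(m + n, m)) (hX : sigma_solution Omega X)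
  (Z : R * R -> 'M[R[i]]_(m + n)) (hZ : associated_surface Omega X Z)
  (xi0 : R * R) (Upsilon : set (R * R)) (hUopen : open Upsilon)
  (hU0 : Upsilon xi0) (hUO : Upsilon `<=` Omega)
  (hdet : forall x, Upsilon x -> detG X x != 0)
  (Phi : R * R -> 'M[R[i]]_(m + n)) (hPhi : smooth_mx Upsilon Phi)
  (hPhiSU : forall x, Upsilon x -> SU (Phi x))
  (hPhiX : forall x, Upsilon x -> X x = Phi x *m col_mx 1%:M 0)
  (tA tB : 'I_(m + n) * 'I_(m + n) -> R * R -> 'M[R[i]]_(m + n))
  (htilde : tilde_matrices Upsilon (pdPhi Phi Z L_) (pdPhi Phi Z R_) tA tB)
  (* e lists the normals; e j is the label of n_{j+3}, 0 <= j < N^2 - 3. *)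
  (e : 'I_((m + n) ^ 2 - 3) -> normal_index m n) (he : bijective e) :
  let nrm := fun j => normal Phi tA tB (e j) in
  (forall x, Upsilon x ->
    [/\ sprod (pd L_ Z x) (pd L_ Z x) = J X L_ x,
        sprod (pd L_ Z x) (pd R_ Z x) = GLR X x,
        sprod (pd R_ Z x) (pd R_ Z x) = J X R_ x,
        forall k, sprod (pd L_ Z x) (nrm k x) = 0 /\
                  sprod (pd R_ Z x) (nrm k x) = 0
      & forall j k, sprod (nrm j x) (nrm k x) = (j == k)%:R]) /\
  (forall x, Upsilon x -> forall B D : bool,
    sprod (pd B (pd B Z) x) (pd D Z x) = ddZ_dZ X B D x) /\
  exists (H QL QR : 'I_((m + n) ^ 2 - 3) -> R * R -> R)
         (sL sR : 'I_((m + n) ^ 2 - 3) -> 'I_((m + n) ^ 2 - 3) -> R * R -> R),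
    forall x, Upsilon x ->
    (forall j k, sL j k x + sL k j x = 0 /\ sR j k x + sR k j x = 0) /\
    [/\ pd L_ (pd L_ Z) x =
          coefA_L X Z L_ x *: pd L_ Z x + coefA_R X Z L_ x *: pd R_ Z x
          + \sum_j (QL j x)%:C *: nrm j x,
        pd R_ (pd R_ Z) x =
          coefA_L X Z R_ x *: pd L_ Z x + coefA_R X Z R_ x *: pd R_ Z x
          + \sum_j (QR j x)%:C *: nrm j x,
        pd L_ (pd R_ Z) x = pd R_ (pd L_ Z) x /\
        pd R_ (pd L_ Z) x = \sum_j (H j x)%:C *: nrm j x,
        forall j, pd L_ (nrm j) x =
          alphaL X (H j x) (QL j x) x *: pd L_ Z x
          + betaL X (H j x) (QL j x) x *: pd R_ Z x
          + \sum_k (sL j k x)%:C *: nrm k x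
      & forall j, pd R_ (nrm j) x =
          alphaR X (H j x) (QR j x) x *: pd L_ Z x
          + betaR X (H j x) (QR j x) x *: pd R_ Z x
          + \sum_k (sR j k x)%:C *: nrm k x].
Proof.
move=> nrm.
have Oof x : Upsilon x -> Omega x by exact: hUO.
have PhiC x : Upsilon x -> Phi x *m (Phi x)^t* = 1%:M.
  by move=> /hPhiSU [/unitarymxP].
have ZPhi D x : Upsilon x -> pd D Z x = Phi x *m pdPhi Phi Z D x *m (Phi x)^t*.
  move=> Ux; rewrite /pdPhi !mulmxA PhiC // mul1mx -mulmxA PhiC //.
  by rewrite mulmx1.
have nrmE j x : nrm j x = Phi x *m tilde_normal tA tB (e j) x *m (Phi x)^t*.
  exact: normal_tildeE.
have ZLL x : Upsilon x -> sprod (pd L_ Z x) (pd L_ Z x) = J X L_ x.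
  by move=> Ux; apply: (sprod_pd_surface_diag hX hZ); exact: Oof.
have ZRR x : Upsilon x -> sprod (pd R_ Z x) (pd R_ Z x) = J X R_ x.
  by move=> Ux; apply: (sprod_pd_surface_diag hX hZ); exact: Oof.
have ZLR x : Upsilon x -> sprod (pd L_ Z x) (pd R_ Z x) = GLR X x.
  by move=> Ux; apply: (sprod_pd_surface_LR hX hZ); exact: Oof.
have Zn D k x : Upsilon x -> sprod (pd D Z x) (nrm k x) = 0.
  move=> Ux; rewrite ZPhi // nrmE (sprod_conj _ _ (hPhiSU x Ux)).
  by have [] := sprod_U_tilde_normal htilde (e k) Ux; case: D.
have nn j k x : Upsilon x -> sprod (nrm j x) (nrm k x) = (j == k)%:R.
  move=> Ux; rewrite !nrmE (sprod_conj _ _ (hPhiSU x Ux)).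
  rewrite (sprod_tilde_normal htilde) //.
  by rewrite (inj_eq (bij_inj he)).
have su_n j x : Upsilon x -> su (nrm j x).
  move=> Ux; rewrite nrmE; apply: su_conj; first exact: hPhiSU.
  exact: (su_tilde_normal htilde).
have smoothZ : smooth_mx Omega Z by case: hZ.
have dn D j x : Upsilon x -> is_pd D (nrm j) x (pd D (nrm j) x).
  move=> Ux; have [dT hT] := is_pd_tilde_normal hUopen htilde D (e j) Ux.
  have dPhi := smooth_is_pd D hPhi Ux.
  have := is_pd_pd (is_pdM (is_pdM dPhi hT) (is_pd_adj dPhi)).
  have -> // : nrm j =
      fun y => Phi y *m tilde_normal tA tB (e j) y *m (Phi y)^t*.
  by apply/funext => y; exact: nrmE.
have su_dn D j x : Upsilon x -> su (pd D (nrm j) x).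
  move=> Ux; apply: (su_is_pd (dn D j x Ux)).
  by apply: filterS (near_open hUopen Ux) => y; exact: su_n.
have ddZ B D x : Omega x -> is_pd B (pd D Z) x (pd B (pd D Z) x).
  by move=> Ox; exact: (smooth_is_pd B (smooth_pd D smoothZ) Ox).
have su_dZ D x : Omega x -> su (pd D Z x).
  move=> Ox; apply: (su_is_pd (smooth_is_pd D smoothZ Ox)).
  by apply: filterS (near_open hOpen Ox) => y; case: hZ => _ + _ _; apply.
have su_ddZ B D x : Omega x -> su (pd B (pd D Z) x).
  move=> Ox; apply: (su_is_pd (ddZ B D x Ox)).
  by apply: filterS (near_open hOpen Ox) => y; exact: su_dZ.
(* The general expansion behind all the equations: any su(N) matrix in terms of the frame, with real
   normal coefficients. *)
have expand x V : Upsilon x -> su V ->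
    V = ((J X R_ x * sprod V (pd L_ Z x) - GLR X x * sprod V (pd R_ Z x))
         / detG X x) *: pd L_ Z x
        + ((J X L_ x * sprod V (pd R_ Z x) - GLR X x * sprod V (pd L_ Z x))
           / detG X x) *: pd R_ Z x
        + \sum_j (complex.Re (sprod V (nrm j x)))%:C *: nrm j x.
  move=> Ux suV.
  pose F := frame_expansion (pd L_ Z x) (pd R_ Z x) V (fun j => nrm j x)
              (J X L_ x) (J X R_ x) (GLR X x).
  have cE j : (complex.Re (sprod V (nrm j x)))%:C = sprod V (nrm j x).
    by apply: su_sprod_real; [case: suV|case: (su_n j x Ux)].
  under eq_bigr do rewrite cE.
  have [WL WR Wn] := @sprod_frame_remainder _ _ _ _ _ V _ _ _ _
    (ZLL x Ux) (ZLR x Ux) (ZRR x Ux)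
    (fun j => Zn L_ j x Ux) (fun j => Zn R_ j x Ux)
    (fun j k => nn j k x Ux) (hdet x Ux).
  have trW : \tr (V - F) = 0.
    apply: tr_frame_remainder; [by case: suV|exact: (su_dZ L_ x (Oof x Ux)).2|
      exact: (su_dZ R_ x (Oof x Ux)).2|by move=> j; exact: (su_n j x Ux).2].
  rewrite -/F in WL WR Wn; apply: (@subr0_eq _ V F).
  move: (V - F) trW WL WR Wn => W trW WL WR Wn.
  (* Pulling the remainder back by [Phi] turns orthogonality to the frame into the hypotheses of
     [tilde_complete]; surjectivity of [e] ensures that every normal is covered. *)
  have : (Phi x)^t* *m W *m Phi x = 0.
    apply: (tilde_complete hm htilde Ux).
    - by rewrite mxtrace_mulC mulmxA PhiC // mul1mx.
    - by rewrite -sprod_conjr -ZPhi.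
    - by rewrite -sprod_conjr -ZPhi.
    - by move=> i; have [g _ gK] := he; rewrite -sprod_conjr -(gK i) -nrmE.
  move=> /(congr1 (fun M => Phi x *m M *m (Phi x)^t*)).
  by rewrite mulmx0 mul0mx !mulmxA PhiC // mul1mx -mulmxA PhiC // mulmx1.
(* Product rule for a scalar product constant on [Upsilon], used with the values 0 and
   [(j == k)%:R]. *)
have dsprod0 D (F G : R * R -> 'M[R[i]]_(m + n)) (c : R[i]) dF dG x :
    Upsilon x ->
    (forall y, Upsilon y -> sprod (F y) (G y) = c) ->
    is_pd D F x dF -> is_pd D G x dG -> sprod dF (G x) + sprod (F x) dG = 0.
  move=> Ux FG hF hG; apply: (is_cderive_unique (is_cderive_sprod hF hG)).
  apply: is_cderive_near (is_cderive_cst _ _ c).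
  by apply: filterS (near_open hUopen Ux) => y Uy; rewrite FG.
have dn_dZ B D j x : Upsilon x ->
    sprod (pd B (nrm j) x) (pd D Z x) = - sprod (pd B (pd D Z) x) (nrm j x).
  move=> Ux; have nZ y : Upsilon y -> sprod (nrm j y) (pd D Z y) = 0.
    by move=> Uy; rewrite sprodC Zn.
  have := dsprod0 B _ _ 0 _ _ x Ux nZ (dn B j x Ux) (ddZ B D x (Oof x Ux)).
  by rewrite (sprodC (nrm j x)) => /eqP; rewrite addr_eq0 => /eqP.
have swapZ x : Upsilon x -> pd L_ (pd R_ Z) x = pd R_ (pd L_ Z) x.
  by move=> Ux; apply: (pd_swap hOpen smoothZ); exact: Oof.
split; first by move=> x Ux; split; auto.
split.
  by move=> x Ux B D; apply: (sprod_pd_pd_surface hOpen hX hZ); exact: Oof.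
pose coef (V : R * R -> 'M[R[i]]_(m + n)) j x :=
  complex.Re (sprod (V x) (nrm j x)).
(* H and Q are the normal components of the second derivatives of [Z], and s those of the
   derivatives of the normals. *)
exists (coef (pd L_ (pd R_ Z))), (coef (pd L_ (pd L_ Z))).
exists (coef (pd R_ (pd R_ Z))).
exists (fun j => coef (pd L_ (nrm j))), (fun j => coef (pd R_ (nrm j))).
move=> x Ux; have Ox := Oof x Ux.
have s_skew D j k :
    coef (pd D (nrm j)) k x + coef (pd D (nrm k)) j x = 0.
  have := dsprod0 D (nrm j) (nrm k) _ _ _ x Ux (fun y => nn j k y)
    (dn D j x Ux) (dn D k x Ux).
  rewrite (sprodC (nrm j x)) => /(congr1 (@complex.Re R)).
  by rewrite raddfD /coef => ->.
have coefE V j : su (V x) -> (coef V j x)%:C = sprod (V x) (nrm j x).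
  by case=> aV _; apply: su_sprod_real => //; case: (su_n j x Ux).
split; first by move=> j k; split; exact: s_skew.
split.
- exact: (expand x _ Ux (su_ddZ L_ L_ x Ox)).
- exact: (expand x _ Ux (su_ddZ R_ R_ x Ox)).
- split; first exact: swapZ.
  rewrite -swapZ //; apply: etrans (expand x _ Ux (su_ddZ L_ R_ x Ox)) _.
  exact: (gram_combination0 _ _ _ _ _ _ _
    (sprod_pd_LR_surface hOpen hX hZ L_ Ox) (sprod_pd_LR_surface hOpen hX hZ R_ Ox)).
- move=> j; apply: etrans (expand x _ Ux (su_dn L_ j x Ux)) _.
  have hQ := coefE (pd L_ (pd L_ Z)) j (su_ddZ L_ L_ x Ox).
  have hH := coefE (pd L_ (pd R_ Z)) j (su_ddZ L_ R_ x Ox).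
  have vL := etrans (dn_dZ L_ L_ j x Ux) (congr1 -%R (esym hQ)).
  have vR := etrans (dn_dZ L_ R_ j x Ux) (congr1 -%R (esym hH)).
  exact: (gram_combinationN _ _ _ _ _ _ _ vL vR).
- move=> j; apply: etrans (expand x _ Ux (su_dn R_ j x Ux)) _.
  have hQ := coefE (pd R_ (pd R_ Z)) j (su_ddZ R_ R_ x Ox).
  have hH := coefE (pd L_ (pd R_ Z)) j (su_ddZ L_ R_ x Ox).
  (* Differentiating [(n_j, d_L Z) = 0] along R produces [d_R d_L Z], whereas H was defined from
     [d_L d_R Z]. *)
  rewrite (swapZ x Ux) in hH.
  have vL := etrans (dn_dZ R_ L_ j x Ux) (congr1 -%R (esym hH)).
  have vR := etrans (dn_dZ R_ R_ j x Ux) (congr1 -%R (esym hQ)).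
  exact: (gram_combinationN _ _ _ _ _ _ _ vL vR).
Qed.
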